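(* Let $N,M\ge 1$ be integers. Let $\boldsymbol\theta(t)\in\mathbb R^M$ be an admissible control, meaning that $\boldsymbol\theta$ is piecewise continuous on $t\in[p,q]$. Suppose the dynamics function $\mathbf f\colon[p,q]\times\mathbb R^N\times\mathbb R^M\to\mathbb R^N$, $(t,\mathbf z,\boldsymbol\theta)\mapsto\mathbf f(t,\mathbf z,\boldsymbol\theta)$, is continuous on $(t,\boldsymbol\theta)\in[p,q]\times\mathbb R^M$ and continuously differentiable on $\mathbf z\in\mathbb R^N$. Let $t\in[p,q]$ and suppose that $\mathbf z(t;p,\mathbf x)$ and $\boldsymbol\theta(t;p,\mathbf x)$ satisfy $$\dot{\mathbf z}(t)=\mathbf f(t,\mathbf z(t),\boldsymbol\theta(t)),\qquad \mathbf z(p)=\mathbf x,$$ for each $\mathbf x\in\mathbb R^N$. Then we have the invariant imbedding relation $$\nabla_p\mathbf z(t;p,\mathbf x)=-\nabla_{\mathbf x}\mathbf z(t;p,\mathbf x)\cdot\boldsymbol\Phi(p,\mathbf x),\qquad\text{where }\boldsymbol\Phi(p,\mathbf x):=\mathbf f(p,\mathbf x,\boldsymbol\theta(p)).$$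
   Context: The endpoint $q$ is fixed, while the input location $p\le q$ and the input value $\mathbf x\in\mathbb R^N$ vary. The notation $\mathbf z(t)=\mathbf z(t;p,\mathbf x)\in\mathbb R^N$ and $\boldsymbol\theta(t)=\boldsymbol\theta(t;p,\mathbf x)\in\mathbb R^M$ makes explicit the dependence of the state and of the control on the input location $p$ and the input value $\mathbf x$, so that $\mathbf z(p;p,\mathbf x)=\mathbf x$ and $\boldsymbol\theta(p)=\boldsymbol\theta(p;p,\mathbf x)$. The dot denotes the derivative in $t$. Here $\nabla_p=\partial/\partial p$, $\nabla_{\mathbf x}\mathbf z(t;p,\mathbf x)=(\partial z_i/\partial x_j)_{i,j}$ is the $N\times N$ Jacobian matrix with respect to $\mathbf x$, and $\cdot$ is matrix multiplication (vectors are columns).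
   Formalization: The z-derivative of f is taken jointly continuous; θ(t;p,x) is assumed continuous in (t,p) at t=p and unchanged on restarting from a reached state; if θ depends on (p,x), z is assumed differentiable at (p,x); t=p only when earlier input locations exist. *)

(* Defs.v *)
(* MathComp-Analysis; column vectors 'cV[R]_N carry the max norm. *)
From HB Require Import structures.
From mathcomp Require Export all_boot all_order all_algebra.
From mathcomp Require Export all_classical all_reals all_analysis.

Set Implicit Arguments.
Unset Strict Implicit.
Unset Printing Implicit Defensive.

Import Order.TTheory GRing.Theory Num.Theory.
Import numFieldNormedType.Exports.

Local Open Scope classical_set_scope.
Local Open Scope ring_scope.

(* Finitely many discontinuities, and finite one-sided limits everywhere.  The
   values at the discontinuities are unconstrained. *)
Definition piecewise_continuous (R : realType) (V : normedModType R)
    (p q : R) (u : R -> V) : Prop :=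
  [/\ exists s : seq R, forall t, t \in `[p, q] -> t \notin s ->
        u r @[r --> within `[p, q] (nbhs t)] --> u t,
      forall t, t \in `[p, q[ -> cvg (u r @[r --> t^'+])
    & forall t, t \in `]p, q] -> cvg (u r @[r --> t^'-])].

(* The library's [jacobian] is the transpose, for row vectors. *)
Definition Jacobian (R : realType) (m n : nat) (g : 'cV[R]_n -> 'cV[R]_m)
    (x : 'cV[R]_n) : 'M[R]_(m, n) :=
  \matrix_(i, j) 'D_(delta_mx j 0) (fun y => g y i 0) x.

(* Besides continuity in (t, theta) and differentiability in z, the derivative
   in z is required to be continuous in the three variables jointly; this makes
   f itself jointly continuous, and locally Lipschitz in z. *)
Definition dynamics_regular (R : realType) (N M : nat) (a q : R)
    (f : R -> 'cV[R]_N -> 'cV[R]_M -> 'cV[R]_N) : Prop :=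
  [/\ forall z, {within [set w : R * 'cV[R]_M | w.1 \in `[a, q]],
        continuous (fun w => f w.1 z w.2)},
      forall t z u, t \in `[a, q] -> differentiable (fun y => f t y u) z
    & {within [set w : R * 'cV[R]_N * 'cV[R]_M | w.1.1 \in `[a, q]],
        continuous (fun w => Jacobian (fun y => f w.1.1 y w.2) w.1.2)}].

(* As the control may jump, the equation is imposed where it is continuous. *)
Definition solves (R : realType) (N M : nat) (p q : R)
    (f : R -> 'cV[R]_N -> 'cV[R]_M -> 'cV[R]_N)
    (x : 'cV[R]_N) (u : R -> 'cV[R]_M) (y : R -> 'cV[R]_N) : Prop :=
  [/\ y p = x,
      {within `[p, q], continuous y}
    & forall t, t \in `]p, q[ -> {for t, continuous u} ->
        is_derive t 1 y (f t (y t) (u t))].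

(* Fréchet differentiability of Z at (p, x), relative to `[a, t] x R^N: the
   state at time t only exists for input locations p <= t. *)
Definition differentiable_input (R : realType) (N : nat) (a t : R)
    (Z : R -> 'cV[R]_N -> 'cV[R]_N) (p : R) (x : 'cV[R]_N) : Prop :=
  exists (c : 'cV[R]_N) (B : 'M[R]_N), forall e : R, 0 < e ->
    \forall w \near within [set w : R * 'cV[R]_N | w.1 \in `[a, t]]
                           (nbhs (p, x)),
      `|Z w.1 w.2 - Z p x - ((w.1 - p) *: c + B *m (w.2 - x))|
        <= e * (`|w.1 - p| + `|w.2 - x|).

(* Two-sided derivative if a < p < t, one-sided if p = a or p = t. *)
Definition nabla_p (R : realType) (N : nat) (a t : R)
    (Z : R -> 'cV[R]_N -> 'cV[R]_N) (p : R) (x : 'cV[R]_N) : 'cV[R]_N :=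
  lim ((r - p)^-1 *: (Z r x - Z p x) @[r --> within `[a, t] p^']).

Definition nabla_x (R : realType) (N : nat)
    (Z : R -> 'cV[R]_N -> 'cV[R]_N) (p : R) (x : 'cV[R]_N) : 'M[R]_N :=
  Jacobian (Z p) x.

(* The control is one and the same function of time for all inputs (p, x). *)
Definition input_independent (R : realType) (N M : nat) (a q : R)
    (theta : R -> R -> 'cV[R]_N -> 'cV[R]_M) : Prop :=
  exists u : R -> 'cV[R]_M, forall (t p : R) (x : 'cV[R]_N),
    a <= p -> p <= t -> t <= q -> theta t p x = u t.

(* Restarting at location s from the state reached there does not change the
   control on [s, q].  Without it the imbedding relation fails: take f = theta
   and theta(t; p, x) = p. *)
Definition control_consistent (R : realType) (N M : nat) (a q : R)
    (z : R -> R -> 'cV[R]_N -> 'cV[R]_N)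
    (theta : R -> R -> 'cV[R]_N -> 'cV[R]_M) : Prop :=
  forall (t s p : R) (x : 'cV[R]_N), a <= p -> p <= s -> s <= t -> t <= q ->
    theta t s (z s p x) = theta t p x.

(* Joint continuity of (s, p') |-> theta(s; p', x) at (p, p); for a control that
   depends on s only, this is continuity at p relative to [a, t]. *)
Definition control_continuous_at_input (R : realType) (N M : nat) (a t : R)
    (theta : R -> R -> 'cV[R]_N -> 'cV[R]_M) (p : R) (x : 'cV[R]_N) : Prop :=
  theta w.1 w.2 x
    @[w --> within [set w : R * R | a <= w.2 /\ w.2 <= w.1 /\ w.1 <= t]
                   (nbhs (p, p))] --> theta p p x.

(* Main.v *)
(* Restarting at [(s, z(s; p, x))] leaves the state at time [t] unchanged, since
   the control does not change either and solutions are unique.  Hence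
   [Z s y = z(t; s, y)] is constant along the trajectory from [(p, x)], whose
   velocity at [p] is [Phi = f p x (theta p p x)], and a first-order expansion of
   [Z] with partial derivatives [c] and [B] satisfies [c + B *m Phi = 0].
   For an open-loop control the expansion exists: by the linearized equation and
   Gronwall's inequality the difference quotients of [Z p] along the axes are
   Cauchy, so no linear differential equation has to be solved, and [Z r y]
   agrees with [Z p (y - (r - p) *: Phi)] up to [o(r - p)]. *)
Require Import Defs.
From mathcomp Require Import all_boot all_order all_algebra.
From mathcomp Require Import all_classical all_reals all_analysis.
From mathcomp Require Import ring lra.

Set Implicit Arguments.
Unset Strict Implicit.
Unset Printing Implicit Defensive.

Import Order.TTheory GRing.Theory Num.Theory.
Import numFieldNormedType.Exports.

Local Open Scope classical_set_scope.
Local Open Scope ring_scope.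

(** * Mean value and Gronwall inequalities off a finite set *)

(** A control may jump, with arbitrary values at its jumps, so a state is differentiable only off a
    finite set. No integral is used: mean value inequalities that tolerate finitely many exceptional
    times yield Gronwall's inequality, uniqueness and the local estimates. The dynamics is Lipschitz
    in the state only on bounded sets, so trajectories must be confined to a ball before they are
    compared; a continuity argument does this, with constants uniform in the starting location. A
    change of the input location is traded for a change of the input value, which needs no
    derivative of the control and works on both sides of [p]. *)

Lemma norm_coord_le (R : realType) m n (A : 'M[R]_(m, n)) i j : `|A i j| <= `|A|.
Proof.
rewrite [leRHS]/Num.Def.normr/= mx_normrE.
exact: (le_bigmax _ (fun ij : 'I_m * 'I_n => `|A ij.1 ij.2|) (i, j)).
Qed.

Lemma norm_le_coord (R : realType) m n (A : 'M[R]_(m, n)) (e : R) :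
  0 <= e -> (forall i j, `|A i j| <= e) -> `|A| <= e.
Proof.
by move=> e0 Ae; rewrite [leLHS]/Num.Def.normr/= mx_normrE; apply: bigmax_le.
Qed.

(** An entry of the product is a sum of [n] terms, so for the max norm the factor [n] appears; it
    recurs in later constants. *)
Lemma norm_mulmx_le (R : realType) m n k (A : 'M[R]_(m, n)) (B : 'M[R]_(n, k)) :
  `|A *m B| <= n%:R * `|A| * `|B|.
Proof.
apply: norm_le_coord => [|i j]; first by rewrite !mulr_ge0.
rewrite mxE (le_trans (ler_norm_sum _ _ _))//.
rewrite -mulrA -[X in X%:R](card_ord n) mulr_natl -sumr_const ler_sum// => l _.
by rewrite normrM ler_pM// norm_coord_le.
Qed.

(* The exceptional points are the jumps of the control. *)
Definition primitive_off_finite (R : realType) (V : normedModType R)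
    (r t : R) (y F : R -> V) : Prop :=
  {within `[r, t], continuous y} /\
  exists e : seq R, forall s, s \in `]r, t[ -> s \notin e ->
    is_derive s 1 y (F s).

Section PrimitiveAlgebra.
Context {R : realType} {V : normedModType R}.
Implicit Types (y F : R -> V) (r t : R).

Lemma primitive_sub r t r' t' y F : r <= r' -> t' <= t ->
  primitive_off_finite r t y F -> primitive_off_finite r' t' y F.
Proof.
move=> rr tt [cy [e ye]]; split.
  by apply: continuous_subspaceW cy; apply: subset_itv; rewrite bnd_simp.
exists e => s /itvP srt; apply: ye.
by rewrite in_itv/= (le_lt_trans rr) ?(lt_le_trans _ tt) ?srt.
Qed.

Lemma eq_primitive r t y F F' : {in `]r, t[, F =1 F'} ->
  primitive_off_finite r t y F -> primitive_off_finite r t y F'.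
Proof.
move=> FF' [cy [e ye]]; split => //; exists e => s srt se.
by rewrite -FF'//; exact: ye.
Qed.

Lemma primitiveD r t y F y' F' :
  primitive_off_finite r t y F -> primitive_off_finite r t y' F' ->
  primitive_off_finite r t (fun s => y s + y' s) (fun s => F s + F' s).
Proof.
move=> [cy [e ye]] [cy' [e' ye']]; split.
  exact: within_continuousD.
exists (e ++ e') => s srt; rewrite mem_cat negb_or => /andP[se se'].
by apply: is_deriveD; [exact: ye|exact: ye'].
Qed.

Lemma primitiveN r t y F : primitive_off_finite r t y F ->
  primitive_off_finite r t (fun s => - y s) (fun s => - F s).
Proof.
move=> [cy [e ye]]; split.
  by move=> s; exact: (continuousN (cy s)).
by exists e => s srt se; apply: is_deriveN; exact: ye.
Qed.

Lemma primitiveB r t y F y' F' :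
  primitive_off_finite r t y F -> primitive_off_finite r t y' F' ->
  primitive_off_finite r t (fun s => y s - y' s) (fun s => F s - F' s).
Proof. by move=> yF /primitiveN; exact: primitiveD. Qed.

Lemma primitiveZ (c : R) r t y F : primitive_off_finite r t y F ->
  primitive_off_finite r t (fun s => c *: y s) (fun s => c *: F s).
Proof.
move=> [cy [e ye]]; split.
  by move=> s; exact: (continuousZl_tmp (cy s)).
by exists e => s srt se; apply: is_deriveZ; exact: ye.
Qed.

Lemma primitive_sum (I : finType) (y F : I -> R -> V) r t :
  (forall i, primitive_off_finite r t (y i) (F i)) ->
  primitive_off_finite r t (fun s => \sum_i y i s) (fun s => \sum_i F i s).
Proof.
move=> yF; elim: (index_enum I) => [|i l IH].
  under eq_fun do rewrite big_nil.
  under [X in primitive_off_finite _ _ _ X]eq_fun do rewrite big_nil.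
  split; first by move=> s; exact: cvg_cst.
  by exists [::] => s _ _; exact: is_derive_cst.
under eq_fun do rewrite big_cons.
under [X in primitive_off_finite _ _ _ X]eq_fun do rewrite big_cons.
exact: primitiveD.
Qed.

Lemma primitive_derivable r t y F : (forall s : R, is_derive s 1 y (F s)) ->
  primitive_off_finite r t y F.
Proof.
move=> yF; split; last by exists [::] => s _ _; exact: yF.
apply: continuous_subspaceT => s.
by apply: differentiable_continuous; apply/derivable1_diffP; case: (yF s).
Qed.

End PrimitiveAlgebra.

Lemma primitive_coord (R : realType) m n (y F : R -> 'M[R]_(m, n)) r t i j :
  primitive_off_finite r t y F ->
  primitive_off_finite r t (fun s => y s i j) (fun s => F s i j).
Proof.
move=> [cy [e ye]]; split.
  move=> s; exact: (@continuous_comp (subspace `[r, t]) _ _ y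
    (fun M : 'M[R]_(m, n) => M i j) s (cy s) (@coord_continuous _ _ _ i j (y s))).
exists e => s srt se; have [dy <-] := ye _ srt se.
rewrite derive_mx// mxE; apply: derivableP.
by move/derivable_mxP : dy.
Qed.

Section MeanValue.
Context {R : realType}.

Lemma is_derive_mulr_cst (c s : R) : is_derive s 1 (fun u => c * u) c.
Proof.
have := @is_deriveZ _ _ _ (@id R) c s 1 1 _; rewrite [_ *: 1]mulr1; exact.
Qed.

(** Induction on the exceptional points: one that lies inside the interval splits it into two
    intervals whose interiors avoid it, and with none left the mean value theorem applies. *)
Lemma primitive_ge0_le (r t : R) (y F : R -> R) : r <= t ->
  primitive_off_finite r t y F -> {in `]r, t[, forall s, 0 <= F s} ->
  y r <= y t.
Proof.
move=> + [+ [e]]; elim: e r t => [|c e IH] r t rt cy ye F0.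
  move: rt; rewrite le_eqVlt => /predU1P[->//|rt].
  have [|s srt E] := @MVT R y F r t rt _ cy; first by move=> s srt; exact: ye.
  by rewrite -subr_ge0 E mulr_ge0 ?F0// subr_ge0 ltW.
have sub r' t' : r <= r' -> r' <= t' -> t' <= t ->
    c \notin `]r', t'[ -> y r' <= y t'.
  move=> rr rt' tt cN.
  have sub s : s \in `]r', t'[ -> s \in `]r, t[.
    by rewrite !in_itv/= => /andP[? ?]; apply/andP; split; lra.
  have cy' : {within `[r', t'], continuous y}.
    by apply: continuous_subspaceW cy; apply: subset_itv; rewrite bnd_simp.
  have ye' s : s \in `]r', t'[ -> s \notin e -> is_derive s 1 y (F s).
    move=> srt se; apply: ye; first exact: sub.
    by rewrite inE negb_or se andbT; apply: contra cN => /eqP <-.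
  by apply: (IH r' t' rt' cy' ye') => s /sub; exact: F0.
have [/[dup] crt|cN] := boolP (c \in `]r, t[); last exact: sub.
rewrite in_itv/= => /andP[rc ct].
apply: (@le_trans _ _ (y c)); apply: sub; rewrite ?(ltW rc) ?(ltW ct)//.
  by rewrite in_itv/= ltxx andbF.
by rewrite in_itv/= ltxx.
Qed.

(** For the max norm each coordinate can be treated alone: monotonicity applies to the sum and to
    the difference of [g] and that coordinate of [y]. *)
Lemma primitive_norm_le n (r t : R) (y F : R -> 'cV[R]_n) (g h : R -> R) :
  r <= t -> primitive_off_finite r t y F -> primitive_off_finite r t g h ->
  {in `]r, t[, forall s, `|F s| <= h s} ->
  `|y t - y r| <= g t - g r.
Proof.
move=> rt yF gh Fh.
have h0 : {in `]r, t[, forall s, 0 <= h s}.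
  by move=> s /Fh; apply: le_trans.
apply: norm_le_coord => [|i j].
  by rewrite subr_ge0; exact: primitive_ge0_le h0.
have bnd s : s \in `]r, t[ -> `|F s i j| <= h s.
  by move=> /Fh; apply: le_trans; exact: norm_coord_le.
rewrite !mxE ler_norml; apply/andP; split.
  have /= := primitive_ge0_le rt (primitiveD gh (primitive_coord i j yF)).
  suff F0 : {in `]r, t[, forall s, 0 <= h s + F s i j} by move=> /(_ F0); lra.
  by move=> s /bnd; rewrite ler_norml => /andP[]; lra.
have /= := primitive_ge0_le rt (primitiveB gh (primitive_coord i j yF)).
suff F0 : {in `]r, t[, forall s, 0 <= h s - F s i j} by move=> /(_ F0); lra.
by move=> s /bnd; rewrite ler_norml => /andP[]; lra.
Qed.

Lemma primitive_norm_le_cst n (r t C : R) (y F : R -> 'cV[R]_n) :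
  r <= t -> primitive_off_finite r t y F ->
  {in `]r, t[, forall s, `|F s| <= C} ->
  `|y t - y r| <= C * (t - r).
Proof.
move=> rt yF FC; rewrite mulrBr.
apply: (primitive_norm_le (g := fun s => C * s) (h := fun=> C) rt yF _ FC).
by apply: primitive_derivable => s; exact: is_derive_mulr_cst.
Qed.

Lemma within_continuous_norm n (r t : R) (y : R -> 'cV[R]_n) :
  {within `[r, t], continuous y} ->
  {within `[r, t], continuous (fun s => `|y s|)}.
Proof. by move=> cy s; apply: cvg_norm; exact: cy. Qed.

(* [m] is the maximum of the norm of [y s] weighted by [expR (- 2 L (s - r))];
   the weight makes the integral of [L * `|y|] at most [m / 2] at the maximum. *)
Lemma gronwall n (r t L eta : R) (y F : R -> 'cV[R]_n) :
  r <= t -> 0 < L -> 0 <= eta -> primitive_off_finite r t y F ->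
  {in `]r, t[, forall s, `|F s| <= L * `|y s| + eta} ->
  forall s, s \in `[r, t] ->
    `|y s| <= 2 * expR (2 * L * (t - r)) * (`|y r| + eta * (t - r)).
Proof.
move=> rt L0 eta0 yF FL s srt.
have [cy _] := yF.
pose w s := expR (- (2 * L * (s - r))).
have w0 s' : 0 < w s' by exact: expR_gt0.
have dexp c (s' : R) : is_derive s' 1 (fun s => expR (c * (s - r)))
    (c * expR (c * (s' - r))).
  have E : is_derive s' 1 (fun s => c * (s - r)) c.
    under eq_fun do rewrite mulrBr.
    rewrite -[X in is_derive _ _ _ X]subr0.
    by apply: is_deriveB; exact: is_derive_mulr_cst.
  by apply: is_derive_eq; rewrite mulrC.
have cw : {within `[r, t], continuous (fun s => w s * `|y s|)}.
  move=> u; apply: cvgM; last exact: (within_continuous_norm cy).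
  have : {within `[r, t], continuous w}; last exact.
  apply: continuous_subspaceT => v.
  have -> : w = fun s => expR (- (2 * L) * (s - r)).
    by apply/funext => u'; rewrite /w mulNr.
  have [dw _] := dexp (- (2 * L)) v.
  exact/differentiable_continuous/derivable1_diffP.
have [c crt maxc] := EVT_max rt cw.
pose m := w c * `|y c|.
have yle u : u \in `[r, t] -> `|y u| <= m * expR (2 * L * (u - r)).
  move=> /maxc; rewrite -/m /w expRN mulrC ler_pdivrMr ?expR_gt0//.
have m0 : 0 <= m by rewrite mulr_ge0// ltW.
have /andP[rc ct] : r <= c <= t by move: crt; rewrite in_itv.
(* Up to [c] the norm of [F] is at most the derivative of
   [m / 2 * expR (2 * L * (s - r)) + eta * s]. Multiplication by [w c] cancels the exponential, and
   absorbing the resulting [m / 2] into [m] produces the factor 2. *)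
have mle : m <= 2 * (`|y r| + eta * (t - r)).
  have := @primitive_norm_le _ r c y F
    (fun s => m / 2 * expR (2 * L * (s - r)) + eta * s)
    (fun s => L * m * expR (2 * L * (s - r)) + eta) rc.
  move=> /(_ (primitive_sub (lexx r) ct yF)) /=.
  have P : primitive_off_finite r c
      (fun s0 => m / 2 * expR (2 * L * (s0 - r)) + eta * s0)
      (fun s0 => L * m * expR (2 * L * (s0 - r)) + eta).
    apply: primitive_derivable => u.
    have -> : L * m * expR (2 * L * (u - r)) =
      (m / 2) *: (2 * L * expR (2 * L * (u - r))) by rewrite /GRing.scale/=; field.
    by apply: is_deriveD; exact: is_derive_mulr_cst.
  move=> /(_ P) {P} /=.
  have B : {in `]r, c[, forall s0, `|F s0| <= L * m * expR (2 * L * (s0 - r)) + eta}.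
    move=> u /itvP urc.
    have utr : u \in `]r, t[ by rewrite in_itv/= !urc (lt_le_trans _ ct) ?urc.
    apply: le_trans (FL _ utr) _; rewrite lerD2r -mulrA ler_pM2l//.
    by apply: yle; exact: subset_itv_oo_cc.
  move=> /(_ B) {B}; rewrite subrr mulr0 expR0 mulr1 => Hc.
  have E : w c * expR (2 * L * (c - r)) = 1 by rewrite /w expRN mulVf// gt_eqF ?expR_gt0.
  have w1 : w c <= 1.
    by rewrite /w expRN invf_le1 ?expR_gt0// -expR0 ler_expR !mulr_ge0 ?subr_ge0// ltW.
  have Hy : `|y c| <= `|y r| + eta * (c - r) + m / 2 * expR (2 * L * (c - r)).
    have : `|y c| <= `|y r| + `|y c - y r|.
      by rewrite -[X in `|X| <= _](subrKC (y r)) ler_normD.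
    lra.
  have Hm : m <= w c * (`|y r| + eta * (c - r)) + m / 2.
    rewrite {1}/m; have := ler_wpM2l (ltW (w0 c)) Hy.
    rewrite [X in _ <= X -> _]mulrDr [X in _ + X]mulrCA E mulr1.
    by rewrite [X in _ <= X -> _]addrC [X in _ -> _ <= X]addrC.
  have A0 : 0 <= `|y r| + eta * (c - r).
    by rewrite addr_ge0// mulr_ge0// subr_ge0.
  have := ler_wpM2r A0 w1; rewrite mul1r => H1.
  have : eta * (c - r) <= eta * (t - r) by rewrite ler_wpM2l// lerD2r.
  lra.
have := yle _ srt; move=> /le_trans; apply.
have st : expR (2 * L * (s - r)) <= expR (2 * L * (t - r)).
  rewrite ler_expR ler_wpM2l//; first by rewrite mulr_ge0// ltW.
  by move/itvP: srt => srt; rewrite lerD2r srt.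
by rewrite [leRHS]mulrAC; exact: (ler_pM m0 (expR_ge0 _) mle st).
Qed.

End MeanValue.

(* At the first time where [phi] reaches [c] the hypothesis would give
   [phi < c]. *)
Lemma continuous_bootstrap (R : realType) (r t c : R) (phi : R -> R) :
  {within `[r, t], continuous phi} -> phi r < c ->
  (forall s, s \in `[r, t] -> (forall u, u \in `[r, s] -> phi u <= c) ->
    phi s < c) ->
  forall s, s \in `[r, t] -> phi s < c.
Proof.
move=> cphi phir step s srt; apply: contrapT => /negP; rewrite -leNgt => cs.
have /andP[rs st] : r <= s <= t by move: srt; rewrite in_itv.
pose E := [set u | u \in `[r, t] /\ c <= phi u].
have lbE : lbound E r by move=> u [/itvP urt _]; rewrite urt.
have infE : has_inf E by split; [exists s|exists r].
have rs0 : r <= inf E by apply: lb_le_inf => //; exists s.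
have s0s : inf E <= s by apply: ge_inf => //; exists r.
have below u : u \in `[r, t] -> u < inf E -> phi u < c.
  move=> urt uE; rewrite ltNge; apply/negP => cu.
  by move: uE; rewrite ltNge => /negP; apply; apply: ge_inf => //; exists r.
have s0rt : inf E \in `[r, t] by rewrite in_itv/= rs0 (le_trans s0s).
have cs0 : {within `[r, inf E], continuous phi}.
  apply: continuous_subspaceW cphi; apply: subset_itv; rewrite bnd_simp//.
  exact: le_trans st.
(* A value above [c] at [inf E] would be preceded by the value [c], although [phi] stays below [c]
   before [inf E]. *)
have s0c : phi (inf E) <= c.
  rewrite leNgt; apply/negP => cphi0.
  have [|u] := IVT rs0 cs0 (v := c).
    by rewrite min_l ?max_r ?(ltW phir) ?(ltW cphi0)//; lra.
  rewrite in_itv/= => /andP[ru us0] uc.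
  have : phi u < c.
    apply: below; first by rewrite in_itv/= ru; lra.
    rewrite lt_neqAle us0 andbT; apply/eqP => us0'.
    by move: cphi0; rewrite -us0' uc ltxx.
  by rewrite uc ltxx.
have {}s0c : phi (inf E) < c.
  apply: step => // u; rewrite in_itv/= => /andP[ru].
  rewrite le_eqVlt => /predU1P[->//|us0]; apply/ltW/below => //.
  by rewrite in_itv/= ru; lra.
(* Continuity keeps [phi] below [c] near [inf E], where [E] has points. *)
move/subspace_continuousP : cphi => /(_ (inf E) s0rt) /cvgrPdist_lt.
move=> /(_ (c - phi (inf E))); rewrite subr_gt0 => /(_ s0c).
rewrite near_withinE => /nbhs_ballP[d /= d0 dP].
have [u [urt cu] uE] := inf_adherent d0 infE.
have uE' : inf E <= u by apply: ge_inf => //; exists r.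
have /= := dP u; rewrite /ball/= => /(_ _ urt).
rewrite distrC ger0_norm ?subr_ge0// => /(_ _).
move=> H; have {}H : `|phi (inf E) - phi u| < c - phi (inf E) by apply: H; lra.
by move: H; rewrite ltr_norml; lra.
Qed.

(** * Compactness of balls and mean value estimates with the Jacobian *)

Section MatrixCalculus.
Context {R : realType}.

Lemma norm_trmx m n (A : 'M[R]_(m, n)) : `|A^T| = `|A|.
Proof.
apply/eqP; rewrite eq_le; apply/andP; split; apply: norm_le_coord => // i j.
  by rewrite mxE norm_coord_le.
have -> : A i j = A^T j i by rewrite mxE.
exact: norm_coord_le.
Qed.

(** Transposition is an isometry, which reduces the claim to row vectors, whose bounded closed sets
    are compact. *)
Lemma compact_norm_le n (rho : R) : compact [set v : 'cV[R]_n | `|v| <= rho].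
Proof.
have -> : [set v : 'cV[R]_n | `|v| <= rho] =
    trmx @` [set v : 'rV[R]_n | `|v| <= rho].
  apply/seteqP; split => v /=.
    by move=> vr; exists v^T; rewrite ?trmxK ?norm_trmx.
  by move=> [w wr <-]; rewrite norm_trmx.
apply: continuous_compact.
  apply: continuous_subspaceT => v U /nbhs_ballP[e e0 eU].
  apply/nbhs_ballP; exists e => // w; rewrite -ball_normE/= => vw.
  by apply: eU; rewrite -ball_normE/= -linearB/= norm_trmx.
apply: bounded_closed_compact.
  exists rho; split; first exact: num_real.
  by move=> M rM v /= /le_trans; apply; exact: ltW.
apply: (@closed_comp _ _ (fun v : 'rV[R]_n => `|v|) [set x | x <= rho]).
  by move=> v _; exact: norm_continuous.
exact: closed_le.
Qed.

Lemma diff_Jacobian m n (g : 'cV[R]_n -> 'cV[R]_m) (x v : 'cV[R]_n) :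
  differentiable g x -> 'd g x v = Jacobian g x *m v.
Proof.
move=> dg.
have E j i : ('d g x (delta_mx j 0)) i 0 = Jacobian g x i j.
  by rewrite -deriveE// derive_mx ?mxE//; exact: diff_derivable.
apply/colP => i; rewrite [in LHS](matrix_sum_delta v) linear_sum mxE summxE.
apply: eq_bigr => j _; rewrite big_ord1 linearZ mxE E mulrC; congr (_ * _).
Qed.

Lemma is_derive_along m n (g : 'cV[R]_n -> 'cV[R]_m) (x v : 'cV[R]_n) (s : R) :
  (forall y, differentiable g y) ->
  is_derive s 1 (fun u => g (x + u *: v)) (Jacobian g (x + s *: v) *m v).
Proof.
move=> dg.
have dl : is_diff s (fun u : R => x + u *: v) (fun u : R => u *: v).
  have dv : is_diff s (fun u : R => u *: v) (fun u : R => u *: v).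
    exact: is_diff_scalel.
  have : is_diff s (cst x + (fun u : R => u *: v)) (0 + (fun u : R => u *: v)).
    exact: is_diffD.
  by rewrite add0r.
have dl1 : differentiable (fun u : R => x + u *: v) s by case: dl.
have dc : differentiable (fun u : R => g (x + u *: v)) s.
  exact: (differentiable_comp dl1 (dg _)).
apply: DeriveDef; first exact: diff_derivable.
rewrite deriveE// -(diff_Jacobian _ (dg _)).
have -> : 'd (fun u : R => g (x + u *: v)) s =
    'd g (x + s *: v) \o 'd (fun u : R => x + u *: v) s :> (R -> 'cV[R]_m).
  exact: (diff_comp dl1 (dg _)).
by rewrite /= diff_val scale1r.
Qed.

(** The mean value inequality applies to [g (y' + s *: v) - s *: (A *m v)] on the unit interval. The
    matrix [A] is free: [0] gives a Lipschitz bound, the Jacobian at [y'] a linearization. *)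
Lemma Jacobian_mean_value m n (g : 'cV[R]_n -> 'cV[R]_m) (A : 'M[R]_(m, n))
    (y y' : 'cV[R]_n) (e : R) :
  (forall x, differentiable g x) ->
  (forall s, s \in `[0, 1] -> `|Jacobian g (y' + s *: (y - y')) - A| <= e) ->
  `|g y - g y' - A *m (y - y')| <= n%:R * e * `|y - y'|.
Proof.
move=> dg Je; set v := y - y'.
have P : primitive_off_finite 0 1
    (fun s => g (y' + s *: v) - s *: (A *m v))
    (fun s => Jacobian g (y' + s *: v) *m v - A *m v).
  apply: primitive_derivable => s; apply: is_deriveB.
    exact: is_derive_along.
  apply: DeriveDef; first exact: diff_derivable.
  by rewrite deriveE// diff_val scale1r.
have := primitive_norm_le_cst ler01 P (C := n%:R * e * `|v|).
rewrite scale0r scale1r addr0 scale0r subr0 [y' + v]subrKC subr0 mulr1 addrAC.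
rewrite scale1r; apply => s s01; rewrite -mulmxBl (le_trans (norm_mulmx_le _ _))//.
by rewrite ler_wpM2r// ler_wpM2l// Je//; exact: subset_itv_oo_cc.
Qed.

End MatrixCalculus.

(** * Uniform estimates for the dynamics on bounded sets *)

Lemma dist_half_le (R : numFieldType) (V : normedZmodType R) (x y z : V) (e : R) :
  `|z - x| < e / 2 -> `|z - y| < e / 2 -> `|x - y| <= e.
Proof.
move=> zx zy; rewrite (le_trans (ler_distD z _ _))// (splitr e) lerD ?ltW//.
by rewrite distrC.
Qed.

Section Dynamics.
Context {R : realType} {N M : nat} (a q : R).
Variable f : R -> 'cV[R]_N -> 'cV[R]_M -> 'cV[R]_N.
Hypothesis hf : dynamics_regular a q f.

Let J t y u := Jacobian (fun y => f t y u) y.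

Let box rho : set (R * 'cV[R]_N * 'cV[R]_M) :=
  `[a, q] `*` [set y | `|y| <= rho] `*` [set u | `|u| <= rho].

Let compact_box rho : compact (box rho).
Proof.
apply: compact_setX; last exact: compact_norm_le.
by apply: compact_setX; [exact: segment_compact|exact: compact_norm_le].
Qed.

Let continuous_J : {within [set w : R * 'cV[R]_N * 'cV[R]_M | w.1.1 \in `[a, q]],
  continuous (fun w => J w.1.1 w.1.2 w.2)}.
Proof. by case: hf. Qed.

Lemma Jacobian_bounded rho : exists2 L : R, 0 < L &
  forall t y u, t \in `[a, q] -> `|y| <= rho -> `|u| <= rho ->
    `|Jacobian (fun y => f t y u) y| <= L.
Proof.
have cJ : {within box rho, continuous (fun w => J w.1.1 w.1.2 w.2)}.
  by apply: continuous_subspaceW continuous_J => w [[]].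
have := compact_bounded (continuous_compact cJ (compact_box (rho := rho))).
move=> [L [_ bL]]; exists (Num.max L 0 + 1); first by rewrite ltr_wpDl// le_max lexx orbT.
move=> t y u taq yr ur; apply: bL; last by exists (t, y, u).
by rewrite (@le_lt_trans _ _ (Num.max L 0)) ?ltrDl// le_max lexx.
Qed.

(** Compactness, in its near-covering form, gives one radius for the whole box: around each of its
    points the Jacobians at [y] and at a nearby [y'] are both compared with the one at the centre,
    at cost [e / 2] each. *)
Lemma Jacobian_unif_continuous rho (e : R) : 0 < e -> exists2 d : R, 0 < d &
  forall t y y' u, t \in `[a, q] -> `|y| <= rho -> `|y'| <= rho ->
    `|u| <= rho -> `|y' - y| < d ->
    `|Jacobian (fun y => f t y u) y' - Jacobian (fun y => f t y u) y| <= e.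
Proof.
move=> e0.
pose P (d : R) (w : R * 'cV[R]_N * 'cV[R]_M) := forall y', `|y' - w.1.2| < d ->
  `|J w.1.1 y' w.2 - J w.1.1 w.1.2 w.2| <= e.
have : \forall d \near 0^'+, box rho `<=` P d.
  have /compact_near_coveringP/near_covering_withinP := compact_box (rho := rho).
  apply=> -[[t y] u] [[/= taq yr] ur].
  have := continuous_J; move=> /subspace_continuousP/(_ (t, y, u) taq).
  move=> /cvgrPdist_lt/(_ (e / 2)); rewrite divr_gt0// => /(_ isT).
  rewrite near_withinE => /nbhs_ballP[d /= d0 dP].
  exists (ball (t, y, u) (d / 2), [set d' | d' < d / 2]).
    split; first by apply: nbhsx_ballx; rewrite divr_gt0.
    exact: nbhs_right_lt (divr_gt0 d0 _).
  move=> [[[t1 y1] u1] d'] [/= [[tt1 yy1] uu1] d'd] [[/= t1aq _] _] y' /= y'y1.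
  have dd : d / 2 <= d by rewrite ler_pdivrMr//; lra.
  have H1 : `|J t y u - J t1 y1 u1| < e / 2.
    by apply: (dP (t1, y1, u1)) => //; split; [split|]; exact: le_ball dd _ _.
  have H2 : `|J t y u - J t1 y' u1| < e / 2.
    apply: (dP (t1, y', u1)) => //; split; [split|]; rewrite /=.
    - exact: le_ball dd _ _.
    - move: yy1; rewrite -!ball_normE/= => yy1.
      by have := ler_distD y1 y y'; rewrite (distrC y1); lra.
    - exact: le_ball dd _ _.
  exact: dist_half_le H2 H1.
move=> Pd; have [d [d0 Hd]] := filter_ex (filterI (nbhs_right_gt 0) Pd).
exists d => // t y y' u taq yr y'r ur; exact: (Hd (t, y, u)).
Qed.

Lemma dynamics_mean_value t y y' u (A : 'M[R]_N) e : t \in `[a, q] ->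
  (forall s, s \in `[0, 1] ->
    `|Jacobian (fun y => f t y u) (y' + s *: (y - y')) - A| <= e) ->
  `|f t y u - f t y' u - A *m (y - y')| <= N%:R * e * `|y - y'|.
Proof.
move=> taq; apply: (Jacobian_mean_value (g := fun y => f t y u)) => x.
by case: hf => _ + _; exact.
Qed.

Let segment_norm_le rho (y y' : 'cV[R]_N) s : `|y| <= rho -> `|y'| <= rho ->
  s \in `[0, 1] -> `|y' + s *: (y - y')| <= rho.
Proof.
move=> yr y'r; rewrite in_itv/= => /andP[s0 s1].
have -> : y' + s *: (y - y') = (1 - s) *: y' + s *: y.
  by rewrite scalerBl scale1r scalerBr addrAC addrA.
rewrite (le_trans (ler_normD _ _))// !normrZ (ger0_norm s0) ger0_norm ?subr_ge0//.
have -> : rho = (1 - s) * rho + s * rho by ring.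
by rewrite lerD// ler_wpM2l// subr_ge0.
Qed.

Lemma dynamics_lipschitz rho : exists2 L : R, 0 < L &
  forall t y y' u, t \in `[a, q] -> `|y| <= rho -> `|y'| <= rho ->
    `|u| <= rho -> `|f t y u - f t y' u| <= L * `|y - y'|.
Proof.
have [L L0 JL] := Jacobian_bounded rho.
exists (N%:R * L + 1) => [|t y y' u taq yr y'r ur].
  by rewrite ltr_wpDl// mulr_ge0// ltW.
have := @dynamics_mean_value t y y' u 0 L taq.
rewrite mul0mx subr0 => H; rewrite (le_trans (H _))//.
  by move=> s s01; rewrite subr0 JL//; exact: segment_norm_le.
by rewrite ler_wpM2r// lerDl.
Qed.

Lemma dynamics_linearization rho e : 0 < e -> exists2 d : R, 0 < d &
  forall t y y' u, t \in `[a, q] -> `|y| <= rho -> `|y'| <= rho ->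
    `|u| <= rho -> `|y - y'| < d ->
    `|f t y u - f t y' u - Jacobian (fun y => f t y u) y' *m (y - y')| <=
      e * `|y - y'|.
Proof.
(* [N.+1] absorbs the factor [N] of the mean value estimate and is never zero. *)
move=> e0; have eN : 0 < e / N.+1%:R by rewrite divr_gt0.
have [d d0 Jd] := Jacobian_unif_continuous rho eN.
exists d => // t y y' u taq yr y'r ur yy'.
rewrite (le_trans (@dynamics_mean_value _ _ _ _ _ (e / N.+1%:R) taq _))//.
  move=> s s01; apply: Jd => //; first exact: segment_norm_le.
  rewrite addrC addKr normrZ; move: s01; rewrite in_itv/= => /andP[s0 s1].
  by rewrite ger0_norm// (le_lt_trans _ yy')// ler_piMl.
rewrite ler_wpM2r// mulrCA; apply: ler_piMr; first exact: ltW.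
rewrite ler_pdivrMr// mul1r.
by rewrite ler_nat.
Qed.

(** Continuity in [(t, u)] at the fixed state [x] and a Lipschitz bound in the state, uniform in [t]
    and [u], combine to joint continuity. *)
Lemma dynamics_continuous p x u0 e : p \in `[a, q] -> 0 < e ->
  exists2 d : R, 0 < d & forall t y u, t \in `[a, q] ->
    `|t - p| < d -> `|y - x| < d -> `|u - u0| < d ->
    `|f t y u - f p x u0| <= e.
Proof.
move=> paq e0.
have [L L0 fL] := dynamics_lipschitz (`|x| + 1 + `|u0|).
have [/(_ x) /subspace_continuousP /(_ (p, u0) paq)] := hf.
move=> /cvgrPdist_lt/(_ (e / 2)); rewrite divr_gt0// => /(_ isT).
rewrite near_withinE => /nbhs_ballP[d /= d0 dP] _ _.
exists (Num.min d (Num.min 1 (e / 2 / L))).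
  by rewrite !lt_min d0 ltr01 !divr_gt0.
move=> t y u taq; rewrite !lt_min => /andP[tp _] /and3P[_ y1 yL] /and3P[ud u1 _].
rewrite (le_trans (ler_distD (f t x u) _ _))// (splitr e) lerD//.
  rewrite (le_trans (fL _ _ _ _ taq _ _ _))//.
  - rewrite -(subrK x y) (le_trans (ler_normD _ _))// addrC -addrA lerD2l.
    by rewrite ler_wpDr// ltW.
  - by rewrite -addrA lerDl addr_ge0.
  - rewrite -(subrK u0 u) (le_trans (ler_normD _ _))// lerD2r.
    by rewrite ler_wpDl// ltW.
  - by rewrite mulrC -ler_pdivlMr// ltW.
rewrite distrC ltW//; apply: (dP (t, u)) => //.
by split; rewrite /= -ball_normE/= distrC.
Qed.

End Dynamics.

(** * Trajectories *)

Lemma within_continuous_bounded (R : realType) n (r t : R) (y : R -> 'cV[R]_n) :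
  {within `[r, t], continuous y} ->
  exists rho : R, forall s, s \in `[r, t] -> `|y s| <= rho.
Proof.
move=> cy; have := compact_bounded (continuous_compact cy (@segment_compact _ r t)).
move=> [L [_ bL]]; exists (L + 1) => s srt.
by apply: bL; rewrite ?ltrDl//; exists s.
Qed.

Section PiecewiseContinuous.
Context {R : realType} {V : normedModType R}.

(** Near each time the one-sided limits bound [u] on the two sides; the value at the time itself,
    which they do not control, is added to the bound. Compactness makes the bound global. *)
Lemma piecewise_continuous_bounded (p q : R) (u : R -> V) :
  piecewise_continuous p q u ->
  exists rho : R, forall s, s \in `[p, q] -> `|u s| <= rho.
Proof.
move=> [_ ur ul].
suff : \forall rho \near +oo, `[p, q]%classic `<=` [set s | `|u s| <= rho].
  by move=> /filter_ex[rho H]; exists rho => s; exact: H.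
have /compact_near_coveringP/near_covering_withinP := @segment_compact _ p q.
apply=> t tpq.
have [d1 d10 [C1 H1]] : exists2 d, 0 < d & exists C, forall s, s \in `[p, q] ->
    t < s -> `|t - s| < d -> `|u s| <= C.
  have [tq|qt] := ltP t q; last first.
    exists 1 => //; exists 0 => s /itvP spq ts.
    by have : s <= q; [rewrite spq|lra].
  have : t \in `[p, q[ by move: tpq; rewrite /= !in_itv/= tq => /andP[->].
  move=> /ur /cvg_ex[l] /cvgrPdist_lt /(_ 1 ltr01).
  rewrite near_withinE => /nbhs_ballP[d /= d0 dP].
  exists d => //; exists (1 + `|l|) => s _ ts sd.
  rewrite -[u s](subrK l) (le_trans (ler_normD _ _))// lerD2r ltW// distrC.
  exact: dP.
have [d2 d20 [C2 H2]] : exists2 d, 0 < d & exists C, forall s, s \in `[p, q] ->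
    s < t -> `|t - s| < d -> `|u s| <= C.
  have [pt|tp] := ltP p t; last first.
    exists 1 => //; exists 0 => s /itvP spq ts.
    by have : p <= s; [rewrite spq|lra].
  have : t \in `]p, q] by move: tpq; rewrite /= !in_itv/= pt => /andP[_ ->].
  move=> /ul /cvg_ex[l] /cvgrPdist_lt /(_ 1 ltr01).
  rewrite near_withinE => /nbhs_ballP[d /= d0 dP].
  exists d => //; exists (1 + `|l|) => s _ ts sd.
  rewrite -[u s](subrK l) (le_trans (ler_normD _ _))// lerD2r ltW// distrC.
  exact: dP.
exists (ball t (Num.min d1 d2), [set C | Num.max `|u t| (Num.max C1 C2) <= C]).
  split; first by apply: nbhsx_ballx; rewrite lt_min d10.
  by apply: nbhs_pinfty_ge; exact: num_real.
move=> [s C] /= [+ +]; rewrite -ball_normE/= lt_min !ge_max.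
move=> /andP[sd1 sd2] /and3P[utC C1C C2C] spq.
have [st|ts|->//] := ltgtP s t.
  exact: le_trans (H2 _ spq st sd2) C2C.
exact: le_trans (H1 _ spq ts sd1) C1C.
Qed.

Lemma piecewise_continuous_off_finite (p q : R) (u : R -> V) :
  piecewise_continuous p q u ->
  exists e : seq R, forall s, s \in `]p, q[ -> s \notin e -> {for s, continuous u}.
Proof.
move=> [[e ue] _ _]; exists e => s spq se.
have spq' : s \in `[p, q] by exact: subset_itv_oo_cc.
have := ue s spq' se; rewrite (_ : within _ _ = nbhs s)//.
apply: within_interior.
suff : `]p, q[ `<=` interior `[p, q] by exact.
by rewrite -open_subsetE; [exact: subset_itv_oo_cc|exact: interval_open].
Qed.

End PiecewiseContinuous.

(** No initial value is fixed and the exceptional times are not tied to the control, so the notion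
    passes to subintervals and to controls that agree on the open interval. *)
Definition trajectory (R : realType) (N M : nat)
    (f : R -> 'cV[R]_N -> 'cV[R]_M -> 'cV[R]_N) (r t : R)
    (u : R -> 'cV[R]_M) (y : R -> 'cV[R]_N) : Prop :=
  primitive_off_finite r t y (fun s => f s (y s) (u s)).

Lemma solves_trajectory (R : realType) (N M : nat) (p q : R)
    (f : R -> 'cV[R]_N -> 'cV[R]_M -> 'cV[R]_N)
    (x : 'cV[R]_N) (u : R -> 'cV[R]_M) (y : R -> 'cV[R]_N) :
  piecewise_continuous p q u -> solves p q f x u y -> trajectory f p q u y.
Proof.
move=> /piecewise_continuous_off_finite[e ue] [_ cy dy]; split => //.
by exists e => s spq se; apply: dy => //; exact: ue.
Qed.

Section Trajectories.
Context {R : realType} {N M : nat} (a q : R).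
Variable f : R -> 'cV[R]_N -> 'cV[R]_M -> 'cV[R]_N.
Hypothesis hf : dynamics_regular a q f.

Lemma trajectory_dist_le (rho L r t : R) (u : R -> 'cV[R]_M)
    (y y' : R -> 'cV[R]_N) :
  0 < L ->
  (forall s z z' v, s \in `[a, q] -> `|z| <= rho -> `|z'| <= rho ->
    `|v| <= rho -> `|f s z v - f s z' v| <= L * `|z - z'|) ->
  a <= r -> r <= t -> t <= q ->
  trajectory f r t u y -> trajectory f r t u y' ->
  {in `[r, t], forall s, [/\ `|y s| <= rho, `|y' s| <= rho & `|u s| <= rho]} ->
  {in `[r, t], forall s,
    `|y s - y' s| <= 2 * expR (2 * L * (t - r)) * `|y r - y' r|}.
Proof.
move=> L0 fL ar rt tq yt y't bnd s srt.
have := @gronwall _ _ r t L 0 _ _ rt L0 (lexx 0) (primitiveB yt y't).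
rewrite mul0r addr0; apply => // s' s'rt.
have s'rt' : s' \in `[r, t] by exact: subset_itv_oo_cc.
rewrite addr0; have [? ? ?] := bnd _ s'rt'; apply: fL => //.
by move: s'rt'; rewrite !in_itv/= => /andP[rs st]; rewrite (le_trans ar)// (le_trans st).
Qed.

Lemma trajectory_unique (r t : R) (u : R -> 'cV[R]_M) (y y' : R -> 'cV[R]_N) :
  a <= r -> r <= t -> t <= q ->
  (exists rho, forall s, s \in `[r, t] -> `|u s| <= rho) ->
  trajectory f r t u y -> trajectory f r t u y' -> y r = y' r -> y t = y' t.
Proof.
move=> ar rt tq [ru uru] yt y't yy'.
have [ry yry] := within_continuous_bounded yt.1.
have [ry' y'ry'] := within_continuous_bounded y't.1.
pose rho := Num.max ru (Num.max ry ry').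
have [L L0 fL] := dynamics_lipschitz hf rho.
have := trajectory_dist_le L0 fL ar rt tq yt y't.
move=> H; have {}H : {in `[r, t], forall s,
    `|y s - y' s| <= 2 * expR (2 * L * (t - r)) * `|y r - y' r|}.
  apply: H => s srt; split.
  - by rewrite (le_trans (yry _ srt))// !le_max lexx !orbT.
  - by rewrite (le_trans (y'ry' _ srt))// !le_max lexx !orbT.
  - by rewrite (le_trans (uru _ srt))// !le_max lexx.
have {H} := H t; rewrite in_itv/= rt lexx => /(_ isT).
by rewrite yy' subrr normr0 mulr0 normr_le0 subr_eq0 => /eqP.
Qed.

(** The same [d] serves all nearby starting locations, controls and trajectories, because a control
    may change with the input location. A continuity argument keeps the state near [x], where the
    velocity is within [e] of [f p x u0]. *)
Lemma trajectory_local_estimate p x u0 e : p \in `[a, q] -> 0 < e ->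
  exists2 d : R, 0 < d & forall r s (v : R -> 'cV[R]_M) (y : R -> 'cV[R]_N),
    a <= r -> r <= s -> s <= q -> `|r - p| < d -> `|s - p| < d ->
    `|y r - x| < d -> (forall s', s' \in `[r, s] -> `|v s' - u0| < d) ->
    trajectory f r s v y ->
    `|y s - y r - (s - r) *: f p x u0| <= e * (s - r).
Proof.
move=> paq e0; have [D D0 fD] := dynamics_continuous hf x u0 paq e0.
pose K := `|f p x u0| + e.
have K0 : 0 < K by rewrite ltr_wpDl.
(* A trajectory starts within [d] of [x] and moves by at most [2 * d * K]; as [d * K + d = D / 4],
   it stays within [D / 2]. *)
pose d := D / (4 * (K + 1)).
have d0 : 0 < d by rewrite divr_gt0// mulr_gt0// addr_gt0.
have dK : d * K + d = D / 4.
  by rewrite /d; field; rewrite ?gt_eqF// addr_gt0.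
have dK0 : 0 < d * K by rewrite mulr_gt0.
have dD : d < D by lra.
exists d => // r s v y ar rs sq rp sp yrx vu yt.
have srd : s - r <= 2 * d by move: rp sp; rewrite !ltr_norml; lra.
have near_p s' : s' \in `[r, s] -> s' \in `[a, q] /\ `|s' - p| < D.
  rewrite !in_itv/= => /andP[rs' s's]; split; first by apply/andP; split; lra.
  by move: rp sp; rewrite !ltr_norml; lra.
have Fb s' : s' \in `[r, s] -> `|y s' - x| <= D / 2 ->
    `|f s' (y s') (v s') - f p x u0| <= e.
  move=> /[dup] s'rs /near_p[s'aq s'p] ys'; apply: fD => //.
    by apply: (le_lt_trans ys'); lra.
  exact: lt_trans (vu _ s'rs) dD.
have close s' : s' \in `[r, s] -> `|y s' - x| < D / 2.
  apply: (continuous_bootstrap (phi := fun s => `|y s - x|)).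
  - apply: within_continuous_norm; apply: within_continuousB yt.1 _ => w.
    exact: cvg_cst.
  - by apply: (lt_trans yrx); lra.
  move=> {}s' s'rs hs'.
  have /andP[rs' s's] : r <= s' <= s by move: s'rs; rewrite in_itv.
  have := primitive_norm_le_cst rs' (primitive_sub (lexx r) s's yt) (C := K).
  move=> H; have {H} : `|y s' - y r| <= K * (s' - r).
    apply: H => w wrs'.
    have wrs'' : w \in `[r, s'] by exact: subset_itv_oo_cc.
    have wrs : w \in `[r, s].
      by move: wrs''; rewrite !in_itv/= => /andP[->]/= /le_trans; exact.
    rewrite -[f w _ _](subrK (f p x u0)) (le_trans (ler_normD _ _))// addrC lerD2l.
    by apply: Fb => //; exact: hs'.
  have Ks : K * (s' - r) <= K * (2 * d) by rewrite ler_pM2l//; lra.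
  have := ler_distD (y r) (y s') x; lra.
have P : primitive_off_finite r s (fun s => y s - s *: f p x u0)
    (fun s => f s (y s) (v s) - f p x u0).
  apply: primitiveB yt _; apply: primitive_derivable => w.
  apply: DeriveDef; first exact: diff_derivable.
  by rewrite deriveE// diff_val scale1r.
have := primitive_norm_le_cst rs P (C := e).
have -> : y s - s *: f p x u0 - (y r - r *: f p x u0) =
    y s - y r - (s - r) *: f p x u0.
  by rewrite scalerBl !opprB addrACA [RHS]addrACA; congr (_ + _); exact: addrC.
apply => w wrs; have wrs' : w \in `[r, s] by exact: subset_itv_oo_cc.
by apply: Fb => //; exact/ltW/close.
Qed.

End Trajectories.

(** * First-order expansions *)

Lemma norm_delta_mx_le (R : realType) m n (i : 'I_m) (j : 'I_n) :
  `|delta_mx i j : 'M[R]_(m, n)| <= 1.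
Proof.
apply: norm_le_coord => // k l; rewrite mxE.
by case: (_ && _); rewrite ?normr1 ?normr0.
Qed.

Lemma mulmx_colE (R : realType) m n (B : 'M[R]_(m, n)) (w : 'cV[R]_n) :
  B *m w = \sum_j w j 0 *: col j B.
Proof.
apply/colP => i; rewrite mxE summxE; apply: eq_bigr => j _.
by rewrite !mxE mulrC.
Qed.

(** The restriction [e <= 1] lets the displacement along a trajectory be bounded independently of
    [e]. *)
Lemma norm_le_eps_eq0 (R : realType) (V : normedModType R) (v : V) (K : R) :
  (forall e, 0 < e -> e <= 1 -> `|v| <= e * K) -> v = 0.
Proof.
move=> vK; apply/eqP; rewrite -normr_le0 leNgt; apply/negP => v0.
have K0 : 0 < K.
  by rewrite ltNge; apply/negP => K0; have := vK 1 ltr01 (lexx 1); lra.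
have e0 : 0 < Num.min 1 (`|v| / (2 * K)) by rewrite lt_min ltr01 divr_gt0 ?mulr_gt0.
have e1 : Num.min 1 (`|v| / (2 * K)) <= 1 by rewrite ge_min lexx.
have := ler_wpM2r (ltW K0) (_ : Num.min 1 (`|v| / (2 * K)) <= `|v| / (2 * K)).
rewrite ge_min lexx orbT => /(_ isT) mK.
have := le_trans (vK _ e0 e1) mK.
have -> : `|v| / (2 * K) * K = `|v| / 2 by field; rewrite gt_eqF.
by rewrite leNgt ltr_pdivrMr// ltr_pMr// ltr1n.
Qed.

Section Frechet.
Context {R : realType} {n : nat}.
Implicit Types (G : 'cV[R]_n -> 'cV[R]_n) (x w : 'cV[R]_n).

(* Applied to [w = k *: delta_mx j 0], the hypothesis says that the difference
   quotients along the axes are Cauchy; their limits are the columns of [B]. *)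
Lemma Frechet_of_quotients G x :
  (forall e, 0 < e -> exists2 d : R, 0 < d & forall w (h : R),
    `|w| < d -> 0 < h -> h < d ->
    `|G (x + w) - G x -
      \sum_j (w j 0 / h) *: (G (x + h *: delta_mx j 0) - G x)| <= e * `|w|) ->
  exists B : 'M[R]_n, forall e, 0 < e -> exists2 d : R, 0 < d &
    forall w, `|w| < d -> `|G (x + w) - G x - B *m w| <= e * `|w|.
Proof.
move=> GE; pose Q j (h : R) := h^-1 *: (G (x + h *: delta_mx j 0) - G x).
have QE e : 0 < e -> exists2 d : R, 0 < d & forall j (h k : R),
    0 < h -> h < d -> 0 < k -> k < d -> `|Q j k - Q j h| <= e.
  move=> e0; have [d d0 dP] := GE _ e0; exists d => // j h k h0 hd k0 kd.
  have kj : `|k *: delta_mx j 0 : 'cV[R]_n| <= k.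
    by rewrite normrZ gtr0_norm// ler_piMr ?norm_delta_mx_le// ltW.
  have := dP (k *: delta_mx j 0) h (le_lt_trans kj kd) h0 hd.
  rewrite (bigD1 j)//= big1 ?addr0; last first.
    by move=> i /negbTE ij; rewrite !mxE ij mulr0 mul0r scale0r.
  rewrite !mxE !eqxx mulr1 => H.
  rewrite -(ler_pM2l k0) -[X in X * `|_|](gtr0_norm k0) -normrZ scalerBr.
  rewrite /Q !scalerA divff ?gt_eqF// scale1r (le_trans H)// mulrC.
  by rewrite ler_wpM2r// ltW.
have Qcvg j : cvg (Q j h @[h --> 0^'+]).
  apply/cauchy_cvgP/cauchy_exP => e e0.
  have [d d0 dP] := QE (e / 2) (divr_gt0 e0 (ltr0Sn _ _)).
  have [e2 d2 d20] : [/\ e / 2 < e, d / 2 < d & 0 < d / 2] by split; lra.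
  exists (Q j (d / 2)); rewrite -ball_normE.
  suff : \forall h \near 0^'+, `|Q j (d / 2) - Q j h| < e by [].
  near=> h.
  apply: (le_lt_trans _ e2); apply: (dP _ _ _ _ _ d20 d2).
    by near: h; exact: nbhs_right_gt.
  by near: h; exact: nbhs_right_lt.
pose D j := lim (Q j h @[h --> 0^'+]).
exists (\matrix_(i, j) D j i 0) => e e0.
(* The error [e / n.+1] is met [n + 1] times: once for the hypothesis, and once for each column when
   its quotient at scale [h] is replaced by the limit. *)
have e'0 : 0 < e / (n.+1%:R) by rewrite divr_gt0.
have [d d0 dP] := GE _ e'0; have [d' d'0 d'P] := QE _ e'0.
exists d => // w wd.
pose h := Num.min d d' / 2.
have m0 : 0 < Num.min d d' by rewrite lt_min d0.
have h0 : 0 < h by rewrite divr_gt0.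
have [hd hd'] : h < d /\ h < d'.
  by apply/andP; rewrite -lt_min /h; lra.
have DQ j : `|Q j h - D j| <= e / n.+1%:R.
  have : (fun k => `|Q j h - Q j k|) @ 0^'+ --> `|Q j h - D j|.
    by apply: cvg_norm; apply: cvgB; [exact: cvg_cst|exact: Qcvg].
  move=> /cvgr_to_le; apply; near=> k; rewrite distrC.
  apply: (d'P _ _ _ h0 hd').
    by near: k; exact: nbhs_right_gt.
  by near: k; exact: nbhs_right_lt.
have Bw : (\matrix_(i, j) D j i 0) *m w = \sum_j w j 0 *: D j.
  rewrite mulmx_colE; apply: eq_bigr => j _; congr (_ *: _).
  by apply/colP => i; rewrite !mxE.
have SQ : \sum_j (w j 0 / h) *: (G (x + h *: delta_mx j 0) - G x) =
    \sum_j w j 0 *: Q j h.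
  by apply: eq_bigr => j _; rewrite /Q scalerA.
rewrite Bw; have := dP _ _ wd h0 hd; rewrite SQ => H.
rewrite (le_trans (ler_distD (\sum_j w j 0 *: Q j h) _ _))//.
have S : `|\sum_j w j 0 *: Q j h - \sum_j w j 0 *: D j| <=
    n%:R * (e / n.+1%:R * `|w|).
  rewrite -sumrB (le_trans (ler_norm_sum _ _ _))//.
  rewrite -[X in X%:R](card_ord n) mulr_natl -sumr_const ler_sum// => j _.
  by rewrite -scalerBr normrZ mulrC ler_pM// norm_coord_le.
rewrite (le_trans (lerD H S))// -[X in X + _]mul1r -mulrDl -nat1r mulrA.
by rewrite mulrCA divff ?mulr1// gt_eqF// ltr_pwDl.
Unshelve. all: by end_near. Qed.

End Frechet.

Section DifferentiableInput.
Context {R : realType} {N : nat} (a t : R).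
Variables (Z : R -> 'cV[R]_N -> 'cV[R]_N) (p : R) (x c : 'cV[R]_N) (B : 'M[R]_N).

(** The two partial derivatives are parameters here, so that [nabla_p] and [nabla_x] can be
    identified with given [c] and [B]. *)
Definition input_expansion : Prop := forall e : R, 0 < e ->
  exists2 d : R, 0 < d & forall r y, r \in `[a, t] -> `|r - p| < d ->
    `|y - x| < d ->
    `|Z r y - Z p x - ((r - p) *: c + B *m (y - x))|
      <= e * (`|r - p| + `|y - x|).

Lemma input_expansionP :
  (forall e : R, 0 < e ->
    \forall w \near within [set w : R * 'cV[R]_N | w.1 \in `[a, t]]
                           (nbhs (p, x)),
      `|Z w.1 w.2 - Z p x - ((w.1 - p) *: c + B *m (w.2 - x))|
        <= e * (`|w.1 - p| + `|w.2 - x|)) <-> input_expansion.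
Proof.
split=> H e /H.
  rewrite near_withinE => /nbhs_ballP[d /= d0 dP]; exists d => // r y rat rp yx.
  apply: (dP (r, y)) => //; split; rewrite /= -ball_normE/= distrC//.
move=> [d d0 dP]; rewrite near_withinE; apply/nbhs_ballP; exists d => //.
move=> [r y] [/=]; rewrite -!ball_normE/= => pr xy rat.
by apply: dP => //; rewrite distrC.
Qed.

Hypothesis HZ : input_expansion.

(** Uniqueness of the limit requires a proper punctured filter: there are points to the right of [p]
    if [p < t], and otherwise to its left, because [a < t]. *)
Lemma nabla_p_expansion : a < t -> p \in `[a, t] -> nabla_p a t Z p x = c.
Proof.
move=> at_; rewrite in_itv/= => /andP[ap pt].
have PF : ProperFilter (within `[a, t] p^').
  apply: Build_ProperFilter_ex => A.
  rewrite /within/= => /nbhs_ballP[d /= d0 dA].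
  have [{}pt|tp] := ltP p t.
    exists (p + Num.min d (t - p) / 2).
    have m0 : 0 < Num.min d (t - p) by rewrite lt_min d0 subr_gt0.
    have [md mt] : Num.min d (t - p) <= d /\ Num.min d (t - p) <= t - p.
      by rewrite !ge_min !lexx orbT.
    apply: dA.
    - by rewrite -ball_normE/= opprD addNKr normrN gtr0_norm ?divr_gt0//; lra.
    - by apply/eqP => E; lra.
    - by rewrite /= in_itv/=; apply/andP; split; lra.
  exists (p - Num.min d (p - a) / 2).
  have pa : a < p by lra.
  have m0 : 0 < Num.min d (p - a) by rewrite lt_min d0 subr_gt0.
  have [md mt] : Num.min d (p - a) <= d /\ Num.min d (p - a) <= p - a.
    by rewrite !ge_min !lexx orbT.
  apply: dA.
  - by rewrite -ball_normE/= subKr gtr0_norm ?divr_gt0//; lra.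
  - by apply/eqP => E; lra.
  - by rewrite /= in_itv/=; apply/andP; split; lra.
apply: cvg_lim => //; apply/cvgrPdist_le => e e0.
have [d d0 dP] := HZ e0.
rewrite near_withinE near_withinE; apply/nbhs_ballP; exists d => // r.
rewrite -ball_normE/= => pr rp rat.
have rp0 : r - p != 0 by rewrite subr_eq0.
rewrite distrC in pr.
have := dP r x rat pr; rewrite subrr normr0 => /(_ d0).
rewrite mulmx0 !addr0 => H.
rewrite -(ler_pM2l (_ : 0 < `|r - p|)) ?normr_gt0//.
rewrite -normrZ scalerBr scalerA divff// scale1r.
by rewrite [leLHS]distrC [leRHS]mulrC.
Qed.

Lemma nabla_x_expansion : p \in `[a, t] -> nabla_x Z p x = B.
Proof.
move=> pat; apply/matrixP => i j; rewrite mxE.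
apply: cvg_lim => //; apply/cvgrPdist_le => e e0.
have [d d0 dP] := HZ e0.
apply/nbhs_ballP; exists d => // h; rewrite -ball_normE/= sub0r normrN => hd h0.
have hj : `|h *: delta_mx j 0 : 'cV[R]_N| <= `|h|.
  by rewrite normrZ ler_piMr ?norm_delta_mx_le.
have := dP p (h *: delta_mx j 0 + x) pat; rewrite subrr normr0 => /(_ d0).
rewrite addrK scale0r !add0r => /(_ (le_lt_trans hj hd)) H.
rewrite -(ler_pM2l (_ : 0 < `|h|)) ?normr_gt0//.
rewrite -normrM mulrBr [h * (_ *: _)]mulrA divff// mul1r distrC [leRHS]mulrC.
have {H} := le_trans H (ler_wpM2l (ltW e0) hj); apply: le_trans.
apply: le_trans (norm_coord_le _ i 0).
by rewrite -scalemxAr -colE !mxE.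
Qed.

End DifferentiableInput.

(** * Differentiability of the flow of an open-loop control *)

Section Flow.
Context {R : realType} {N M : nat} (a p t q : R).
Variables (f : R -> 'cV[R]_N -> 'cV[R]_M -> 'cV[R]_N) (u : R -> 'cV[R]_M).
Variables (z : R -> R -> 'cV[R]_N -> 'cV[R]_N) (x : 'cV[R]_N).
Hypotheses (hf : dynamics_regular a q f) (ap : a <= p) (pt : p <= t) (tq : t <= q).
Hypothesis bounded_u : exists rho, forall s, s \in `[a, t] -> `|u s| <= rho.
Hypothesis continuous_u : forall e, 0 < e -> exists2 d : R, 0 < d &
  forall s, s \in `[a, t] -> `|s - p| < d -> `|u s - u p| < e.
Hypothesis z_init : forall r y, r \in `[a, t] -> z r r y = y.
Hypothesis z_traj : forall r y, r \in `[a, t] -> trajectory f r t u (fun s => z s r y).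

Let sub_at (r s : R) : p <= r -> s \in `[r, t] -> s \in `[a, t] /\ s \in `[a, q].
Proof.
have [ap' pt' tq'] := And3 ap pt tq.
by move=> pr; rewrite !in_itv/= => /andP[rs st]; split; apply/andP; split; lra.
Qed.

Let expR_time_le L r s : 0 < L -> p <= r -> s <= t ->
  expR (2 * L * (s - r)) <= expR (2 * L * (t - p)).
Proof.
move=> L0 pr st; rewrite ler_expR ler_wpM2l ?mulr_ge0 ?(ltW L0)//.
by rewrite lerB.
Qed.

Lemma flow_semigroup (r s : R) y : a <= r -> r <= s -> s <= t -> z t s (z s r y) = z t r y.
Proof.
have [ap' pt' tq'] := And3 ap pt tq.
move=> ar rs st.
have sat : s \in `[a, t] by rewrite in_itv/=; apply/andP; split; lra.
have rat : r \in `[a, t] by rewrite in_itv/=; apply/andP; split; lra.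
apply: (@trajectory_unique _ _ _ a q f hf s t u (fun w => z w s (z s r y))
  (fun w => z w r y)) => //; first lra.
- have [ru Hru] := bounded_u; exists ru => w; rewrite in_itv/= => /andP[sw wt].
  by apply: Hru; rewrite in_itv/= wt andbT; lra.
- exact: z_traj.
- exact: primitive_sub rs (lexx t) (z_traj y rat).
- exact: z_init.
Qed.

(** The reference trajectory is bounded by [rho - 1]. While another one stays within distance 1 of
    it, both lie in the ball of radius [rho], so Gronwall's inequality applies and gives a distance
    below 1 again; a continuity argument closes the circle. *)
Lemma flow_tube : exists rho C d : R, [/\ 0 < C, 0 < d,
  forall s, s \in `[a, t] -> `|u s| <= rho &
  forall (r : R) y, r \in `[p, t] -> `|y - z r p x| < d -> forall s : R, s \in `[r, t] ->
    [/\ `|z s r y - z s p x| <= C * `|y - z r p x|,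
      `|z s r y| <= rho & `|z s p x| <= rho]].
Proof.
have [ap' pt' tq'] := And3 ap pt tq.
have pat : p \in `[a, t] by rewrite in_itv/= ap.
have [ru Hru] := bounded_u.
have [rz Hrz] := within_continuous_bounded (z_traj x pat).1.
pose rho := Num.max ru (rz + 1).
have urho (s : R) : s \in `[a, t] -> `|u s| <= rho.
  by move=> sat; rewrite le_max Hru.
have zrho (s : R) : s \in `[p, t] -> `|z s p x| <= rho - 1.
  move=> /Hrz zs; rewrite lerBrDr (@le_trans _ _ (rz + 1)) ?lerD2r//.
  by rewrite le_max lexx orbT.
have [L L0 fL] := dynamics_lipschitz hf rho.
pose C := 2 * expR (2 * L * (t - p)).
have C0 : 0 < C by rewrite mulr_gt0// expR_gt0.
have C1 : 0 < C + 1 by rewrite ltr_wpDl// ltW.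
(* [C] times an initial distance below [(C + 1)^-1] is less than 1, the threshold of the continuity
   argument. *)
exists rho, C, (C + 1)^-1; split => //; first by rewrite invr_gt0.
move=> r y rpt yd.
have /andP[pr rt] : p <= r <= t by move: rpt; rewrite in_itv.
have rat : r \in `[a, t] by rewrite in_itv/= rt (le_trans ap pr).
have step (s : R) : s \in `[r, t] ->
    (forall w : R, w \in `[r, s] -> `|z w r y - z w p x| <= 1) ->
    `|z s r y - z s p x| <= C * `|y - z r p x|.
  move=> srt hs; have /andP[rs st] : r <= s <= t by move: srt; rewrite in_itv.
  have H := @trajectory_dist_le _ _ _ a q f rho L r s u (fun w => z w r y)
    (fun w => z w p x) L0 fL (le_trans ap pr) rs (le_trans st tq)
    (primitive_sub (lexx r) st (z_traj y rat))
    (primitive_sub pr st (z_traj x pat)).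
  have {H} := H _ s; rewrite (z_init _ rat) in_itv/= rs lexx => H.
  rewrite (le_trans (H _ isT))//.
    move=> w wrs; have wpt : w \in `[p, t].
      by move: wrs; rewrite !in_itv/= => /andP[? ?]; apply/andP; split; lra.
    have [wat _] := sub_at (lexx p) wpt.
    have zw := zrho _ wpt.
    split; last exact: urho.
      rewrite -[z w r y](subrK (z w p x)) (le_trans (ler_normD _ _))//.
      by rewrite -[leRHS](subrKC 1) lerD// hs.
    by rewrite (le_trans zw)// gerBl.
  by rewrite ler_wpM2r// ler_wpM2l// expR_time_le.
have Cd : C * `|y - z r p x| < 1.
  apply: (@le_lt_trans _ _ (C * (C + 1)^-1)).
    by rewrite ler_wpM2l// ltW.
  by rewrite ltr_pdivrMr// mul1r ltrDl.
have close (s : R) : s \in `[r, t] -> `|z s r y - z s p x| < 1.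
  apply: (continuous_bootstrap (phi := fun s => `|z s r y - z s p x|)).
  - apply: within_continuous_norm; apply: within_continuousB.
      exact: (z_traj y rat).1.
    exact: (primitive_sub pr (lexx t) (z_traj x pat)).1.
  - rewrite z_init// (lt_trans yd)// invf_lt1// ltrDr//.
  - by move=> w wrt hw; rewrite (le_lt_trans (step _ wrt hw)).
move=> s srt; have spt : s \in `[p, t].
  by move: srt; rewrite !in_itv/= => /andP[? ?]; apply/andP; split; lra.
split.
- apply: step => // w wrs; apply/ltW/close.
  by move: srt wrs; rewrite !in_itv/= => /andP[? ?] /andP[? ?]; apply/andP; split; lra.
- rewrite -[z s r y](subrK (z s p x)) (le_trans (ler_normD _ _))//.
  by rewrite -[leRHS](subrKC 1) lerD ?zrho// ltW// close.
- by rewrite (le_trans (zrho _ spt))// gerBl.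
Qed.

(** [C] and [d] do not depend on [r]: this bound carries errors made near [p] to time [t], from
    whichever of [r] and [p] is later. *)
Lemma flow_lipschitz : exists C d : R, [/\ 0 < C, 0 < d &
  forall (r : R) y y', r \in `[p, t] -> `|y - z r p x| < d -> `|y' - z r p x| < d ->
    `|z t r y - z t r y'| <= C * `|y - y'|].
Proof.
have [ap' pt' tq'] := And3 ap pt tq.
have [rho [C [d [_ d0 urho tube]]]] := flow_tube.
have [L L0 fL] := dynamics_lipschitz hf rho.
exists (2 * expR (2 * L * (t - p))), d; split => //.
  by rewrite mulr_gt0// expR_gt0.
move=> r y y' rpt yd y'd.
have /andP[pr rt] : p <= r <= t by move: rpt; rewrite in_itv.
have rat : r \in `[a, t] by rewrite in_itv/= rt (le_trans ap pr).
have H := @trajectory_dist_le _ _ _ a q f rho L r t u (fun w => z w r y)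
    (fun w => z w r y') L0 fL (le_trans ap pr) rt tq (z_traj y rat) (z_traj y' rat).
have {H} := H _ t; rewrite !(z_init _ rat) in_itv/= rt lexx => H.
rewrite (le_trans (H _ isT))//.
  move=> w wrt; have [wat _] := sub_at pr wrt.
  have [_ zw _] := tube _ _ rpt yd _ wrt.
  have [_ zw' _] := tube _ _ rpt y'd _ wrt.
  by split => //; exact: urho.
by rewrite ler_wpM2r// ler_wpM2l// expR_time_le.
Qed.

(* The defect [v] between an increment of the flow and the combination of
   difference quotients solves the linearized equation up to a small error. *)
Lemma flow_quotients e : 0 < e -> exists2 d : R, 0 < d & forall w (h : R),
  `|w| < d -> 0 < h -> h < d ->
  `|z t p (x + w) - z t p x -
    \sum_j (w j 0 / h) *: (z t p (x + h *: delta_mx j 0) - z t p x)| <= e * `|w|.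
Proof.
have [ap' pt' tq'] := And3 ap pt tq.
move=> e0; have [rho [C [d [C0 d0 urho tube]]]] := flow_tube.
have pat : p \in `[a, t] by rewrite in_itv/= ap.
have ppt : p \in `[p, t] by rewrite in_itv/= lexx.
have [L L0 JL] := Jacobian_bounded hf rho.
pose L' := N%:R * L + 1.
have L'0 : 0 < L' by rewrite ltr_wpDl// mulr_ge0// ltW.
(* The Gronwall factor, the duration, and [N + 1] linearization errors, one for the increment along
   [w] and [N] for the quotients; [C] is the growth in the tube. *)
pose K := 2 * expR (2 * L' * (t - p)) * (t - p) * (C * N.+1%:R).
have K0 : 0 <= K by rewrite !mulr_ge0 ?expR_ge0 ?subr_ge0 ?(ltW C0).
have K1 : 0 < K + 1 by rewrite ltr_wpDl.
have [e1 e10 e1K] : exists2 e1 : R, 0 < e1 & e1 * K <= e.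
  exists (e / (K + 1)); first by rewrite divr_gt0.
  by rewrite mulrAC ler_pdivrMr// ler_pM2l// lerDl.
have [d1 d10 lin] := dynamics_linearization hf rho e10.
exists (Num.min d (d1 / C)); first by rewrite lt_min d0 divr_gt0.
move=> w h; rewrite !lt_min => /andP[wd wd1] h0 /andP[hd hd1].
rewrite ltr_pdivlMr// mulrC in wd1; rewrite ltr_pdivlMr// mulrC in hd1.
pose A s := Jacobian (fun y => f s y (u s)) (z s p x).
pose D v s := z s p (x + v) - z s p x.
pose F v s := f s (z s p (x + v)) (u s) - f s (z s p x) (u s).
have DF v : primitive_off_finite p t (D v) (F v).
  exact: primitiveB (z_traj (x + v) pat) (z_traj x pat).
have near_z (v : 'cV[R]_N) : x + v - z p p x = v by rewrite z_init// addrC addKr.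
have FD v (s : R) : `|v| < d -> C * `|v| < d1 -> s \in `[p, t] ->
    `|F v s - A s *m D v s| <= e1 * (C * `|v|).
  move=> vd vd1 spt; have [_ saq] := sub_at (lexx p) spt.
  have [sat _] := sub_at (lexx p) spt.
  have := tube p (x + v) ppt; rewrite near_z => /(_ vd _ spt)[zC zr z0r].
  rewrite (le_trans (lin _ _ _ _ saq zr z0r (urho _ sat) _))//.
    exact: le_lt_trans zC vd1.
  by rewrite ler_wpM2l// ltW.
pose c (j : 'I_N) := w j 0 / h.
pose b (j : 'I_N) : 'cV[R]_N := h *: delta_mx j 0.
pose V s := D w s - \sum_j c j *: D (b j) s.
pose G s := F w s - \sum_j c j *: F (b j) s.
have VG : primitive_off_finite p t V G.
  by apply: primitiveB (DF w) _; apply: primitive_sum => j; exact: primitiveZ.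
have bh j : `|b j| <= h.
  by rewrite normrZ gtr0_norm// ler_piMr ?norm_delta_mx_le// ltW.
have GE s : G s = A s *m V s +
    (F w s - A s *m D w s - \sum_j c j *: (F (b j) s - A s *m D (b j) s)).
  have -> : \sum_j c j *: (F (b j) s - A s *m D (b j) s) =
      \sum_j c j *: F (b j) s - \sum_j A s *m (c j *: D (b j) s).
    by rewrite -sumrB; apply: eq_bigr => j _; rewrite scalerBr scalemxAr.
  by rewrite /V mulmxBr mulmx_sumr opprB addrACA subrKC addKr.
have Gb (s : R) : s \in `]p, t[ -> `|G s| <= L' * `|V s| + e1 * (C * N.+1%:R * `|w|).
  move=> spt'; have spt : s \in `[p, t] by exact: subset_itv_oo_cc.
  have [sat saq] := sub_at (lexx p) spt.
  rewrite GE (le_trans (ler_normD _ _))// lerD//.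
    rewrite (le_trans (norm_mulmx_le _ _))// ler_wpM2r//.
    rewrite (@le_trans _ _ (N%:R * L)) ?lerDl// ler_wpM2l// JL//.
    - have := tube p x ppt; rewrite z_init// subrr normr0 => /(_ d0 _ spt).
      by case.
    - exact: urho.
  rewrite -nat1r mulrDr mulr1 [(_ + _) * `|w|]mulrDl mulrDr.
  rewrite (le_trans (ler_normB _ _))// lerD//; first exact: FD.
  rewrite (le_trans (ler_norm_sum _ _ _))//.
  have -> : e1 * (C * N%:R * `|w|) = (e1 * (C * `|w|)) *+ #|'I_N|.
    by rewrite card_ord -mulr_natl; ring.
  rewrite -sumr_const ler_sum// => j _.
  have bd : `|b j| < d by exact: le_lt_trans (bh j) hd.
  have bd1 : C * `|b j| < d1 by apply: le_lt_trans hd1; rewrite ler_pM2l.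
  (* The weight [w j 0 / h] times an increment of size [h] is at most the norm of [w], so the error
     does not depend on [h]. *)
  rewrite normrZ (le_trans (ler_wpM2l (normr_ge0 _) (FD _ _ bd bd1 spt)))//.
  rewrite /c normrM normfV (gtr0_norm h0).
  have -> : e1 * (C * `|w|) = `|w| / h * (e1 * (C * h)).
    by field; rewrite gt_eqF.
  apply: ler_pM.
  - by rewrite divr_ge0// ltW.
  - by rewrite !mulr_ge0 ?(ltW e10) ?(ltW C0).
  - by rewrite ler_wpM2r ?invr_ge0 ?(ltW h0)// norm_coord_le.
  - by rewrite !ler_pM2l.
(* At time [p] the flow is the identity, so the combination of quotients reproduces [w] exactly. *)
have Vp : V p = 0.
  have Dp v : D v p = v by rewrite /D !z_init// [x + v]addrC addrK.
  rewrite /V Dp; apply/eqP; rewrite subr_eq0; apply/eqP.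
  rewrite [LHS]matrix_sum_delta; apply: eq_bigr => j _.
  by rewrite big_ord1 Dp scalerA divfK// gt_eqF.
have eta0 : 0 <= e1 * (C * N.+1%:R * `|w|) by rewrite !mulr_ge0 ?(ltW e10) ?(ltW C0).
have := gronwall pt L'0 eta0 VG Gb; move=> /(_ t); rewrite in_itv/= pt lexx.
move=> /(_ isT); rewrite Vp normr0 add0r => H; apply: (le_trans H).
have -> : 2 * expR (2 * L' * (t - p)) * (e1 * (C * N.+1%:R * `|w|) * (t - p)) =
  e1 * K * `|w| by rewrite /K; ring.
by rewrite ler_wpM2r.
Qed.

(** Both inputs nearly lie on one trajectory. With [w] the shifted displacement, the trajectory from
    [(p, x + w)] is close to [y] at time [r] if [p <= r], and the one from [(r, y)] is close to
    [x + w] at time [p] if [r < p]. The semigroup property and the Lipschitz bound carry this to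
    time [t]. *)
Lemma flow_input_shift e : 0 < e -> exists2 d : R, 0 < d & forall (r : R) y,
  r \in `[a, t] -> `|r - p| < d -> `|y - x| < d ->
  `|z t r y - z t p (x + (y - x - (r - p) *: f p x (u p)))| <= e * `|r - p|.
Proof.
have [ap' pt' tq'] := And3 ap pt tq.
move=> e0; have [C [d2 [C0 d20 lipz]]] := flow_lipschitz.
have [rho [C' [d3 [C'0 d30 urho tube]]]] := flow_tube.
have paq : p \in `[a, q] by rewrite in_itv/= ap (le_trans pt).
have pat : p \in `[a, t] by rewrite in_itv/= ap.
have ppt : p \in `[p, t] by rewrite in_itv/= lexx.
set Phi := f p x (u p).
pose e1 := e / C.
have e10 : 0 < e1 by rewrite divr_gt0.
have [d1 d10 loc] := trajectory_local_estimate hf x (u p) paq e10.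
have [d4 d40 ud4] := continuous_u d10.
pose K := 1 + `|Phi| + e1.
have K0 : 0 < K by rewrite ltr_wpDr ?(ltW e10)// ltr_pwDl.
(* [d * (2 * K) <= m] keeps the displacement [w] and the local error together within [m / 2]; the
   entry [d2 / C'] allows for the growth of [w] along the tube. *)
pose m := Num.min (Num.min d1 d2) (Num.min d3 (d2 / C')).
have m0 : 0 < m by rewrite !lt_min d10 d20 d30 divr_gt0.
pose d := Num.min d4 (m / (2 * K)).
have d0 : 0 < d by rewrite lt_min d40 divr_gt0// mulr_gt0.
have d4d : d <= d4 by rewrite ge_min lexx.
have dK : d * (2 * K) <= m.
  by rewrite -ler_pdivlMr ?mulr_gt0// ge_min lexx orbT.
have [[md1 md2] [md3 md2']] : (m <= d1 /\ m <= d2) /\ (m <= d3 /\ m * C' <= d2).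
  rewrite -ler_pdivlMr//; split; split; by rewrite /m !ge_min lexx ?orbT.
exists d => // r y rat rp yx; set w := y - x - (r - p) *: Phi.
have /andP[ar rt] : a <= r <= t by move: rat; rewrite in_itv.
have dK' : d * K = d + d * `|Phi| + d * e1 by rewrite /K; ring.
have [dPhi0 de1] : 0 <= d * `|Phi| /\ 0 < d * e1.
  by split; [rewrite mulr_ge0// ltW|rewrite mulr_gt0].
have rpe : e1 * `|r - p| <= d * e1 by rewrite mulrC ler_wpM2r// ltW.
have wd : `|w| <= d + d * `|Phi|.
  rewrite (le_trans (ler_normB _ _))// lerD ?(ltW yx)// normrZ ler_wpM2r//.
  exact: ltW.
have dd1 : d < d1 by lra.
have up (s' b c : R) : b \in `[a, t] -> c \in `[a, t] -> `|b - p| < d -> `|c - p| < d ->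
    s' \in `[b, c] -> `|u s' - u p| < d1.
  rewrite !in_itv/= => /andP[ab bt] /andP[ac ct] bp cp /andP[bs sc].
  apply: ud4; first by rewrite in_itv/=; apply/andP; split; lra.
  by move: bp cp; rewrite !ltr_norml; lra.
have pp : `|p - p| < d by rewrite subrr normr0.
have [pr|rp'] := leP p r.
  have rpt : r \in `[p, t] by rewrite in_itv/= pr.
  have xw : x + w - z p p x = w by rewrite z_init// addrC addKr.
  have L1 : `|z r p (x + w) - (x + w) - (r - p) *: Phi| <= e1 * (r - p).
    have := loc p r u (fun s => z s p (x + w)) ap pr (le_trans rt tq).
    rewrite z_init//; apply; [lra|lra| |by move=> s' s'rp; exact: up s'rp|].
      by rewrite addrC addKr; lra.
    exact: primitive_sub (lexx p) rt (z_traj (x + w) pat).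
  have E : z r p (x + w) - (x + w) - (r - p) *: Phi = z r p (x + w) - y.
    rewrite -addrA -opprD (_ : x + w + _ = y)//.
    by rewrite /w -addrA subrK subrKC.
  rewrite E in L1; rewrite -(ger0_norm (_ : 0 <= r - p)) in L1; last by rewrite subr_ge0.
  have T : `|z r p (x + w) - z r p x| < d2 / 2.
    have := tube p (x + w) ppt; rewrite xw => H.
    have {H} [||H _ _] := H _ r; [lra|done|].
    rewrite (le_lt_trans H)// mulrC.
    rewrite (@le_lt_trans _ _ ((d + d * `|Phi|) * C'))//; first by rewrite ler_wpM2r// ltW.
    have : (d + d * `|Phi| + d * e1) * 2 * C' <= m * C' by rewrite ler_wpM2r ?(ltW C'0)//; lra.
    have : 0 < d * e1 * C' by rewrite mulr_gt0.
    lra.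
  rewrite -(flow_semigroup (x + w) ap pr rt).
  have yd : `|y - z r p (x + w)| <= e1 * `|r - p| by rewrite distrC.
  rewrite (le_trans (lipz _ _ _ rpt _ _))//.
  - rewrite (le_lt_trans (ler_distD (z r p (x + w)) _ _))//.
    by lra.
  - by lra.
  - rewrite (le_trans (ler_wpM2l (ltW C0) yd))// mulrA /e1 mulrCA divff ?mulr1//.
    by rewrite gt_eqF.
have rp1 : r <= p by exact: ltW.
have L1 : `|z p r y - y - (p - r) *: Phi| <= e1 * (p - r).
  have := loc r p u (fun s => z s r y) ar rp1 (le_trans pt tq).
  rewrite z_init//; apply; [lra|lra|lra|by move=> s' s'rp; exact: up s'rp|].
  exact: primitive_sub (lexx r) pt (z_traj y rat).
have E : z p r y - y - (p - r) *: Phi = z p r y - (x + w).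
  rewrite -addrA -opprD (_ : y + _ = x + w)//.
  by rewrite -(opprB r p) scaleNr /w addrA subrKC.
rewrite E -(ger0_norm (_ : 0 <= p - r)) ?subr_ge0// [X in e1 * X]distrC in L1.
rewrite -(flow_semigroup y ar rp1 pt).
have wd2 : `|x + w - z p p x| < d2 / 2 by rewrite z_init// addrC addKr; lra.
rewrite (le_trans (lipz _ _ _ ppt _ _))//.
- rewrite (le_lt_trans (ler_distD (x + w) _ _))//; lra.
- lra.
- rewrite (le_trans (ler_wpM2l (ltW C0) L1))// mulrA /e1 mulrCA divff ?mulr1//.
  by rewrite gt_eqF.
Qed.

(** The shifted displacement [y - x - (r - p) *: Phi] forces [c = - (B *m Phi)]: its image under [B]
    is the linear part of the expansion. *)
Lemma flow_input_expansion : exists c B, input_expansion a t (z t) p x c B.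
Proof.
have [B HB] := Frechet_of_quotients flow_quotients.
set Phi := f p x (u p).
exists (- (B *m Phi)), B => e e0.
(* The total error is [e / K] times a combination of the distances in location and in value, with
   coefficients [1] plus the norm of [Phi], and [1]; [K] exceeds both. *)
pose K := 2 + `|Phi|.
have K0 : 0 < K by rewrite ltr_pwDl.
have e10 : 0 < e / K by rewrite divr_gt0.
have [d1 d10 H1] := HB _ e10.
have [d2 d20 H2] := flow_input_shift e10.
have m0 : 0 < Num.min d2 (d1 / (2 * K)) by rewrite lt_min d20 divr_gt0// mulr_gt0.
exists (Num.min d2 (d1 / (2 * K))) => // r y rat.
rewrite !lt_min => /andP[rp2 rp1] /andP[yx2 yx1].
rewrite ltr_pdivlMr ?mulr_gt0// in rp1; rewrite ltr_pdivlMr ?mulr_gt0// in yx1.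
set w := y - x - (r - p) *: Phi.
have wle : `|w| <= `|y - x| + `|r - p| * `|Phi|.
  by rewrite (le_trans (ler_normB _ _))// normrZ.
have rPhi : 0 <= `|r - p| * `|Phi| by rewrite mulr_ge0.
have yPhi : 0 <= `|y - x| * `|Phi| by rewrite mulr_ge0.
have r0 := normr_ge0 (r - p).
have wd1 : `|w| < d1 by move: rp1 yx1; rewrite /K; lra.
have Bw : (r - p) *: - (B *m Phi) + B *m (y - x) = B *m w.
  by rewrite /w [RHS]mulmxBr -scalemxAr scalerN addrC.
rewrite Bw (_ : z t r y - _ - _ = (z t r y - z t p (x + w)) +
    (z t p (x + w) - z t p x - B *m w)); last first.
  by rewrite [RHS]addrA subrKA.
rewrite (le_trans (ler_normD _ _))// (le_trans (lerD (H2 _ _ rat rp2 yx2) (H1 _ wd1)))//.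
rewrite -mulrDr mulrAC ler_pdivrMr// -mulrA ler_pM2l// /K.
rewrite [leRHS]mulrC mulrDl mulrDr; move: wle; rewrite (mulrC `|Phi|).
have := normr_ge0 (r - p); have := normr_ge0 (y - x); lra.
Qed.

End Flow.

(** * The imbedding relation *)

(* If [p < t], the expansion of [Z] along the trajectory from [(p, x)], on which
   [Z] is constant, gives [c + B *m f p x (theta p p x) = 0].  If [p = t], then
   [Z p] is the identity and the same equation comes from earlier locations. *)
Lemma imbedding_relation (R : realType) (N M : nat) (a q : R)
  (f : R -> 'cV[R]_N -> 'cV[R]_M -> 'cV[R]_N)
  (z : R -> R -> 'cV[R]_N -> 'cV[R]_N)
  (theta : R -> R -> 'cV[R]_N -> 'cV[R]_M)
  (hf : dynamics_regular a q f)
  (htheta : forall (p : R) (x : 'cV[R]_N), p \in `[a, q] ->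
     piecewise_continuous p q (fun s => theta s p x))
  (hz : forall (p : R) (x : 'cV[R]_N), p \in `[a, q] ->
     solves p q f x (fun s => theta s p x) (fun s => z s p x))
  (hcons : control_consistent a q z theta)
  (p t : R) (x : 'cV[R]_N)
  (hp : p \in `[a, q]) (ht : t \in `[p, q]) (hat : a < t)
  (hcont : control_continuous_at_input a t theta p x)
  (c : 'cV[R]_N) (B : 'M[R]_N) :
  input_expansion a t (z t) p x c B -> c = - (B *m f p x (theta p p x)).
Proof.
move=> HZ; set Phi := f p x _.
have /andP[ap pq] : a <= p <= q by move: hp; rewrite in_itv.
have /andP[pt tq] : p <= t <= q by move: ht; rewrite in_itv.
have traj r y : r \in `[a, q] ->
    trajectory f r q (fun s => theta s r y) (fun s => z s r y).
  by move=> raq; apply: solves_trajectory (htheta r y raq) (hz r y raq).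
have init r y : r \in `[a, q] -> z r r y = y by case/(hz r y).
have cont e : 0 < e -> exists2 d : R, 0 < d & forall s r : R, a <= r -> r <= s ->
    s <= t -> `|r - p| < d -> `|s - p| < d ->
    `|theta s r x - theta p p x| < e.
  move=> e0; move: hcont => /cvgrPdist_lt/(_ e e0).
  rewrite near_withinE => /nbhs_ballP[d /= d0 dP]; exists d => // s r ar rs st rp sp.
  rewrite distrC; apply: (dP (s, r)) => //.
  by split; rewrite /= -ball_normE/= distrC.
(* The state starts at [x], but the location [r] is free: the case [p < t] takes [r = p], the case
   [p = t] takes [s = p]. *)
have loc e : 0 < e -> exists2 d : R, 0 < d & forall r s : R, a <= r -> r <= s ->
    s <= t -> `|r - p| < d -> `|s - p| < d ->
    `|z s r x - x - (s - r) *: Phi| <= e * (s - r).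
  move=> e0.
  have [d1 d10 H1] := trajectory_local_estimate hf x (theta p p x) hp e0.
  have [d2 d20 H2] := cont _ d10.
  exists (Num.min d1 d2) => [|r s ar rs st]; first by rewrite lt_min d10.
  rewrite !lt_min => /andP[rp1 rp2] /andP[sp1 sp2].
  have sq : s <= q by exact: le_trans st tq.
  have raq : r \in `[a, q] by rewrite in_itv/= ar (le_trans rs).
  have := H1 r s (fun s => theta s r x) (fun s => z s r x) ar rs sq rp1 sp1.
  rewrite init// subrr normr0; apply => //.
    move=> w; rewrite in_itv/= => /andP[rw ws]; apply: H2 => //.
      exact: le_trans st.
    by move: rp2 sp2; rewrite !ltr_norml; lra.
  exact: primitive_sub (lexx r) sq (traj r x raq).
suff : c + B *m Phi = 0 by move=> /eqP; rewrite addr_eq0 => /eqP.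
have [{}pt|tp] := ltP p t.
  (* Per unit of time, the expansion at the point reached costs [e] times [1] plus the speed bound;
     the summand with [B] comes from replacing the displacement by [(s - p) *: Phi]. *)
  apply: (@norm_le_eps_eq0 _ _ _ (1 + (`|Phi| + 1) + N%:R * `|B|)) => e e0 e1.
  have [d1 d10 H1] := HZ _ e0.
  have [d2 d20 H2] := loc _ e0.
  have K0 : 0 < `|Phi| + 1 by rewrite ltr_wpDl.
  pose m := Num.min (Num.min d1 d2) (Num.min (t - p) (d1 / (`|Phi| + 1))).
  have m0 : 0 < m by rewrite !lt_min d10 d20 subr_gt0 pt divr_gt0.
  have [[md1 md2] [mt mK]] : (m <= d1 /\ m <= d2) /\
      (m <= t - p /\ m * (`|Phi| + 1) <= d1).
    by rewrite -ler_pdivlMr//; split; split; rewrite /m !ge_min lexx ?orbT.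
  pose s := p + m / 2.
  have sp : s - p = m / 2 by rewrite /s addrC addKr.
  have h0 : 0 < m / 2 by rewrite divr_gt0.
  have [ps st] : p <= s /\ s <= t by rewrite /s; split; lra.
  have as_ : a <= s by exact: le_trans ps.
  have sq : s <= q by exact: le_trans tq.
  have nsp : `|s - p| = m / 2 by rewrite sp gtr0_norm.
  have saq : s \in `[a, q] by rewrite in_itv/= as_.
  have sat : s \in `[a, t] by rewrite in_itv/= as_.
  (* Consistency turns the control of the restarted trajectory into that of the original one, so
     that uniqueness for a single control applies. *)
  have E : z t s (z s p x) = z t p x.
    apply: (@trajectory_unique _ _ _ a q f hf s t (fun w => theta w p x)
      (fun w => z w s (z s p x)) (fun w => z w p x)) => //.
    - have [rho Hrho] := piecewise_continuous_bounded (htheta p x hp).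
      exists rho => w; rewrite in_itv/= => /andP[sw wt]; apply: Hrho.
      by rewrite in_itv/= (le_trans ps)// (le_trans wt).
    - apply: (@eq_primitive _ _ s t (fun w => z w s (z s p x))
        (fun w => f w (z w s (z s p x)) (theta w s (z s p x)))).
        move=> w; rewrite in_itv/= => /andP[/ltW sw /ltW wt].
        by rewrite hcons// (le_trans wt).
      exact: primitive_sub (lexx s) tq (traj s (z s p x) saq).
    - exact: primitive_sub ps tq (traj p x hp).
    - by rewrite init.
  set y := z s p x.
  have Ly : `|y - x - (s - p) *: Phi| <= e * (s - p).
    by apply: H2 => //; rewrite ?subrr ?normr0 ?nsp//; lra.
  have yx : `|y - x| <= (s - p) * (`|Phi| + 1).
    rewrite -[y - x](subrK ((s - p) *: Phi)) (le_trans (ler_normD _ _))//.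
    rewrite addrC mulrDr mulr1 lerD//; first by rewrite normrZ nsp sp.
    by rewrite (le_trans Ly)// ler_piMl// sp ltW.
  have yd : `|y - x| < d1.
    by rewrite (le_lt_trans yx)// sp mulrAC ltr_pdivrMr//; lra.
  have := H1 s y sat; rewrite E subrr sub0r normrN nsp => /(_ _ yd) H.
  have {}H : `|(s - p) *: c + B *m (y - x)| <= e * (m / 2 + `|y - x|).
    by apply: H; lra.
  have D : (s - p) *: (c + B *m Phi) = ((s - p) *: c + B *m (y - x)) -
      B *m (y - x - (s - p) *: Phi).
    rewrite [B *m (y - x - _)]mulmxBr opprB addrACA subrr addr0.
    by rewrite -scalemxAr scalerDr.
  rewrite -(ler_pM2l h0) -{1}nsp -normrZ D (le_trans (ler_normB _ _))//.
  rewrite (le_trans (lerD H (norm_mulmx_le _ _)))//.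
  have -> : m / 2 * (e * (1 + (`|Phi| + 1) + N%:R * `|B|)) =
     e * (m / 2 + m / 2 * (`|Phi| + 1)) + N%:R * `|B| * (e * (m / 2)) by ring.
  rewrite -!sp lerD//; first by rewrite ler_pM2l// lerD2l.
  by rewrite ler_wpM2l ?mulr_ge0.
have {}tp : t = p by apply/eqP; rewrite eq_le tp.
have Zp y : z t p y = y by rewrite tp init.
(* Since [Z p] is the identity, the expansion is tested on the displacement [h *: Phi]. *)
have BPhi : B *m Phi = Phi.
  apply/eqP; rewrite -subr_eq0; apply/eqP.
  apply: (@norm_le_eps_eq0 _ _ _ `|Phi|) => e e0 _.
  have [d d0 H] := HZ _ e0.
  have K0 : 0 < `|Phi| + 1 by rewrite ltr_wpDl.
  pose h := d / (`|Phi| + 1).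
  have h0 : 0 < h by rewrite divr_gt0.
  have hPhi : h * `|Phi| < d.
    by rewrite /h mulrAC ltr_pdivrMr// ltr_pM2l// ltrDl.
  have pat : p \in `[a, t] by rewrite in_itv/= ap tp lexx.
  have := H p (x + h *: Phi) pat; rewrite subrr normr0 => /(_ d0).
  rewrite !Zp [x + _]addrC addrK normrZ (gtr0_norm h0) => /(_ hPhi).
  rewrite scale0r !add0r -scalemxAr -scalerBr normrZ (gtr0_norm h0) mulrCA.
  by rewrite ler_pM2l// distrC.
rewrite BPhi; apply: (@norm_le_eps_eq0 _ _ _ 2) => e e0 _.
have [d1 d10 H1] := HZ _ e0.
have [d2 d20 H2] := loc _ e0.
(* As [p = t] and [a < t], there is an earlier location [r]. From [(r, x)] to time [p] the state
   changes by about [(r - p) *: c] according to the expansion and by about [(p - r) *: Phi]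
   according to the dynamics. *)
have pa : 0 < p - a by rewrite subr_gt0 -tp.
pose m := Num.min (Num.min d1 d2) (p - a).
have m0 : 0 < m by rewrite !lt_min d10 d20.
have [[md1 md2] ma] : (m <= d1 /\ m <= d2) /\ m <= p - a.
  by split; [split|]; rewrite /m !ge_min lexx ?orbT.
pose r := p - m / 2.
have rp : p - r = m / 2 by rewrite /r subKr.
have h0 : 0 < m / 2 by rewrite divr_gt0.
have nrp : `|r - p| = m / 2 by rewrite distrC rp gtr0_norm.
have [ar rp'] : a <= r /\ r <= p by rewrite /r; split; lra.
have rat : r \in `[a, t] by rewrite in_itv/= ar tp rp'.
have := H1 r x rat; rewrite subrr normr0 mulmx0 !addr0 nrp Zp => /(_ _ d10) A1.
have {}A1 : `|z t r x - x - (r - p) *: c| <= e * (m / 2) by apply: A1; lra.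
have A2 : `|z t r x - x - (p - r) *: Phi| <= e * (p - r).
  rewrite -{1}tp; have := H2 r p ar rp'; rewrite tp lexx subrr normr0 nrp => /(_ isT).
  by apply; lra.
rewrite -(ler_pM2l h0) -{1}rp -{1}(ger0_norm (_ : 0 <= p - r)) ?subr_ge0//.
rewrite -normrZ.
have -> : (p - r) *: (c + Phi) = (z t r x - x - (r - p) *: c) -
    (z t r x - x - (p - r) *: Phi).
  rewrite -(opprB p r) scaleNr; move: (p - r) (z t r x - x) => h W.
  by rewrite opprK opprB scalerDr [RHS]addrC subrKA addrC.
rewrite (le_trans (ler_normB _ _))// (le_trans (lerD A1 A2))// rp; lra.
Qed.

(** Differentiability can fail for a consistent feedback: with [f = theta] and [theta] the absolute
    value of a scalar state, the state at a time after [p] has different one-sided derivatives in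
    [x] at [0]. Hence it is a conclusion for open-loop controls and a premise of the relation
    otherwise. *)
Theorem theorem1 (R : realType) (N M : nat) (hN : (1 <= N)%N) (hM : (1 <= M)%N)
  (a q : R)
  (f : R -> 'cV[R]_N -> 'cV[R]_M -> 'cV[R]_N)
  (z : R -> R -> 'cV[R]_N -> 'cV[R]_N)
  (theta : R -> R -> 'cV[R]_N -> 'cV[R]_M)
  (hf : dynamics_regular a q f)
  (htheta : forall (p : R) (x : 'cV[R]_N), p \in `[a, q] ->
     piecewise_continuous p q (fun s => theta s p x))
  (hz : forall (p : R) (x : 'cV[R]_N), p \in `[a, q] ->
     solves p q f x (fun s => theta s p x) (fun s => z s p x))
  (hcons : control_consistent a q z theta)
  (p t : R) (x : 'cV[R]_N)
  (hp : p \in `[a, q]) (ht : t \in `[p, q]) (hat : a < t)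
  (hcont : control_continuous_at_input a t theta p x) :
  (input_independent a q theta -> differentiable_input a t (z t) p x) /\
  (differentiable_input a t (z t) p x ->
     nabla_p a t (z t) p x = - (nabla_x (z t) p x *m f p x (theta p p x))).
Proof.
have /andP[ap pq] : a <= p <= q by move: hp; rewrite in_itv.
have /andP[pt tq] : p <= t <= q by move: ht; rewrite in_itv.
split=> [[u hu]|[c [B /input_expansionP HZ]]]; last first.
  have pat : p \in `[a, t] by rewrite in_itv/= ap.
  rewrite (nabla_p_expansion HZ)// (nabla_x_expansion HZ)//.
  exact: (imbedding_relation hf htheta hz hcons hp ht hat hcont HZ).
have taq r : r \in `[a, t] -> r \in `[a, q].
  by rewrite !in_itv/= => /andP[-> /le_trans]; exact.
have aaq : a \in `[a, q] by rewrite in_itv/= lexx (le_trans ap).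
suff [c [B HZ]] : exists c B, input_expansion a t (z t) p x c B.
  by exists c, B; apply/input_expansionP.
apply: (@flow_input_expansion R N M a p t q f u z x hf ap pt tq).
(* The input [(a, x)] exhibits the common control on the whole of [[a, q]]. *)
- have [rho Hrho] := piecewise_continuous_bounded (htheta a x aaq).
  exists rho => s sat; rewrite -(hu s a x) ?Hrho ?taq//.
    by move: sat; rewrite in_itv => /andP[].
  by move/taq : sat; rewrite in_itv => /andP[].
- move=> e e0; move: hcont => /cvgrPdist_lt/(_ e e0).
  rewrite near_withinE => /nbhs_ballP[d /= d0 dP]; exists d => // s.
  rewrite in_itv/= => /andP[as_ st] sp.
  (* On the diagonal, joint continuity becomes continuity of [u] at [p] relative to [[a, t]],
     including times before [p]. *)
  have := dP (s, s); rewrite !hu//=; last exact: le_trans tq.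
  rewrite distrC; apply; rewrite ?lexx//.
  by split; rewrite /= -ball_normE/= distrC.
- by move=> r y /taq raq; case: (hz r y raq).
- move=> r y /[dup] /taq raq; rewrite in_itv/= => /andP[ar rt].
  apply: (primitive_sub (lexx r) tq).
  apply: eq_primitive (solves_trajectory (htheta r y raq) (hz r y raq)).
  by move=> s; rewrite in_itv/= => /andP[/ltW rs /ltW sq]; rewrite hu.
Qed.
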